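(* The theory $T^\infty_{1/2}$ has quantifier elimination.
   Context: Let $\mathcal{H}$ be the Boolean algebra of subsets of $[0,1)$ generated by the sets $[a,b)$ with $0\le a<b\le 1$, and $\mathcal{H}_0=\mathcal{H}\setminus\{\emptyset,[0,1)\}$. Let $\mathcal{Q}=(\mathbb{N}\times\mathcal{H}_0)\cup\{\bot,\top\}$ ($\bot,\top$ new symbols), with operations: for $m,n\in\mathbb{N}$, $X,Y\in\mathcal{H}_0$, $(m,X)\sqcap(n,Y)=(m,X\cap Y)$ if $m=n$ and $\bot$ otherwise; $(m,X)\sqcup(n,Y)=(m,X\cup Y)$ if $m=n$ and $\top$ otherwise; $(m,X)^{\textsf{c}}=(m,[0,1)\setminus X)$; $\bot\sqcap b=\bot$, $\top\sqcap b=b$, $\bot\sqcup b=b$, $\top\sqcup b=\top$ (and symmetrically); $\bot^{\textsf{c}}=\top$, $\top^{\textsf{c}}=\bot$. Define a binary relation $\mathrm{In}$ on $[0,1)^{\mathbb{N}}\times\mathcal{Q}$ by: $a\mathrel{\mathrm{In}} b$ iff $b=\top$, or $b=(n,X)\in\mathbb{N}\times\mathcal{H}_0$ and $a(n)\in X$. A cube is a nonempty set $\prod_{n\in\mathbb{N}}[a_n,b_n)\subseteq[0,1)^{\mathbb{N}}$ with $a_n=0,b_n=1$ for all but finitely many $n$. Fix a countably infinite $S\subseteq[0,1)^{\mathbb{N}}$ meeting every cube and such that $(a,n)\mapsto a(n)$ is injective on $S\times\mathbb{N}$. Let $\mathcal{L}$ have three sorts $P,Q,R$, a binary relation $\mathrm{In}$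 on $P\times Q$, a binary relation $\sim$ on $Q$, a function $\ell\colon Q\to R$, symbols $\sqcap,\sqcup,{}^{\textsf{c}},\bot,\top$ on $Q$, and $+,<,0,1$ on $R$. The $\mathcal{L}$-structure $M^\infty_{1/2}$ has $P=S$, $Q=\mathcal{Q}$ with the operations above, $R=(\mathbb{R},+,<,0,1)$, $\mathrm{In}$ as defined (restricted to $S\times\mathcal{Q}$), $b\sim c$ iff $b,c\in\mathbb{N}\times\mathcal{H}_0$ have the same first coordinate, and $\ell((n,X))=\lambda(X)$ (Lebesgue measure), $\ell(\bot)=0$, $\ell(\top)=1$. $T^\infty_{1/2}=\mathrm{Th}(M^\infty_{1/2})$. *)

(* Defs.v *)
From HB Require Import structures.
From mathcomp Require Import all_boot all_order all_algebra.
From mathcomp Require Import all_classical all_reals all_analysis.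

Set Implicit Arguments.
Unset Strict Implicit.
Unset Printing Implicit Defensive.

Import Order.TTheory GRing.Theory Num.Theory.
Import numFieldNormedType.Exports.

Local Open Scope classical_set_scope.
Local Open Scope ring_scope.

(* First-order logic with equality over the three-sorted language
   In, ~, ell, meet, join, complement, bot, top, +, <, 0, 1. *)

Inductive sort := SP | SQ | SR.

Definition eq_sort (s t : sort) : bool :=
  match s, t with
  | SP, SP | SQ, SQ | SR, SR => true
  | _, _ => false
  end.

Lemma eq_sortP : Equality.axiom eq_sort.
Proof. by case; case; constructor. Qed.

HB.instance Definition _ := hasDecEq.Build sort eq_sortP.

(* (s, n) is the n-th variable of sort s. *)
Definition var : eqType := (sort * nat)%type.

Inductive term : sort -> Type :=
| Var (x : var) : term x.1
| TCap : term SQ -> term SQ -> term SQ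
| TCup : term SQ -> term SQ -> term SQ
| TCompl : term SQ -> term SQ
| TBot : term SQ
| TTop : term SQ
| TEll : term SQ -> term SR
| TAdd : term SR -> term SR -> term SR
| TZero : term SR
| TOne : term SR.

Inductive formula : Type :=
| FEq (s : sort) : term s -> term s -> formula
| FIn : term SP -> term SQ -> formula
| FSim : term SQ -> term SQ -> formula
| FLt : term SR -> term SR -> formula
| FNot : formula -> formula
| FAnd : formula -> formula -> formula
| FOr : formula -> formula -> formula
| FEx : var -> formula -> formula
| FAll : var -> formula -> formula.

Fixpoint tvars (s : sort) (t : term s) : seq var :=
  match t with
  | Var x => [:: x]
  | TCap t1 t2 | TCup t1 t2 | TAdd t1 t2 => tvars t1 ++ tvars t2
  | TCompl t1 | TEll t1 => tvars t1
  | TBot | TTop | TZero | TOne => [::]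
  end.

Fixpoint fv (phi : formula) : seq var :=
  match phi with
  | FEq _ t1 t2 => tvars t1 ++ tvars t2
  | FIn t1 t2 => tvars t1 ++ tvars t2
  | FSim t1 t2 => tvars t1 ++ tvars t2
  | FLt t1 t2 => tvars t1 ++ tvars t2
  | FNot p => fv p
  | FAnd p q | FOr p q => fv p ++ fv q
  | FEx x p | FAll x p => [seq y <- fv p | y != x]
  end.

Definition sentence (phi : formula) : Prop := fv phi = [::].

Fixpoint quantifier_free (phi : formula) : bool :=
  match phi with
  | FEq _ _ _ | FIn _ _ | FSim _ _ | FLt _ _ => true
  | FNot p => quantifier_free p
  | FAnd p q | FOr p q => quantifier_free p && quantifier_free q
  | FEx _ _ | FAll _ _ => false
  end.

Record structure := Structure {
  car : sort -> Type;
  car_inhabited : forall s, inhabited (car s);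
  s_In : car SP -> car SQ -> Prop;
  s_sim : car SQ -> car SQ -> Prop;
  s_ell : car SQ -> car SR;
  s_cap : car SQ -> car SQ -> car SQ;
  s_cup : car SQ -> car SQ -> car SQ;
  s_compl : car SQ -> car SQ;
  s_bot : car SQ;
  s_top : car SQ;
  s_add : car SR -> car SR -> car SR;
  s_lt : car SR -> car SR -> Prop;
  s_zero : car SR;
  s_one : car SR }.

Definition assignment (M : structure) := forall x : var, car M x.1.

Fixpoint eval (M : structure) (v : assignment M) (s : sort) (t : term s) :
    car M s :=
  match t in term s return car M s with
  | Var x => v x
  | TCap t1 t2 => s_cap (eval v t1) (eval v t2)
  | TCup t1 t2 => s_cup (eval v t1) (eval v t2)
  | TCompl t1 => s_compl (eval v t1)
  | TBot => s_bot M
  | TTop => s_top M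
  | TEll t1 => s_ell (eval v t1)
  | TAdd t1 t2 => s_add (eval v t1) (eval v t2)
  | TZero => s_zero M
  | TOne => s_one M
  end.

Fixpoint sat (M : structure) (v : assignment M) (phi : formula) : Prop :=
  match phi with
  | FEq _ t1 t2 => eval v t1 = eval v t2
  | FIn t1 t2 => s_In (eval v t1) (eval v t2)
  | FSim t1 t2 => s_sim (eval v t1) (eval v t2)
  | FLt t1 t2 => s_lt (eval v t1) (eval v t2)
  | FNot p => ~ sat v p
  | FAnd p q => sat v p /\ sat v q
  | FOr p q => sat v p \/ sat v q
  | FEx x p => exists a : car M x.1, sat (eqtype.dfwith v a) p
  | FAll x p => forall a : car M x.1, sat (eqtype.dfwith v a) p
  end.

Definition valid_in (M : structure) (phi : formula) : Prop :=
  forall v : assignment M, sat v phi.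

Definition theory := set formula.

Definition Th (M : structure) : theory :=
  [set phi | sentence phi /\ valid_in M phi].

Definition model (T : theory) (M : structure) : Prop :=
  forall phi, T phi -> valid_in M phi.

Definition has_quantifier_elimination (T : theory) : Prop :=
  forall phi : formula, exists psi : formula,
    [/\ quantifier_free psi,
        {subset fv psi <= fv phi} &
        forall M : structure, model T M ->
          forall v : assignment M, sat v phi <-> sat v psi].

Section HalfOpen.
Variable R : realType.

Definition I01 : set R := `[0, 1[.

Inductive calH : set R -> Prop :=
| calH_itv (a b : R) : 0 <= a -> a < b -> b <= 1 -> calH `[a, b[
| calH_set0 : calH set0
| calH_I01 : calH I01
| calH_cap X Y : calH X -> calH Y -> calH (X `&` Y)
| calH_cup X Y : calH X -> calH Y -> calH (X `|` Y)
| calH_compl X : calH X -> calH (I01 `\` X).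

Definition calH0 (X : set R) : Prop := [/\ calH X, X <> set0 & X <> I01].

Inductive calQ :=
| QBot
| QTop
| QElt (n : nat) (X : {X : set R | calH0 X}).

(* The pair (n, X) for X in calH, where (n, set0) is identified with QBot
   and (n, [0,1)) with QTop. *)
Definition qpair (n : nat) (X : set R) (hX : calH X) : calQ :=
  match pselect (X = set0), pselect (X = I01) with
  | left _, _ => QBot
  | _, left _ => QTop
  | right h0, right h1 => QElt n (exist _ X (And3 hX h0 h1))
  end.

Definition calH0W (X : {X : set R | calH0 X}) : calH (sval X) :=
  let: And3 h _ _ := svalP X in h.

Definition qcap (b c : calQ) : calQ :=
  match b, c with
  | QBot, _ | _, QBot => QBot
  | QTop, d | d, QTop => d
  | QElt m X, QElt n Y =>
      if m == n then qpair m (calH_cap (calH0W X) (calH0W Y)) else QBot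
  end.

Definition qcup (b c : calQ) : calQ :=
  match b, c with
  | QTop, _ | _, QTop => QTop
  | QBot, d | d, QBot => d
  | QElt m X, QElt n Y =>
      if m == n then qpair m (calH_cup (calH0W X) (calH0W Y)) else QTop
  end.

Definition qcompl (b : calQ) : calQ :=
  match b with
  | QBot => QTop
  | QTop => QBot
  | QElt n X => qpair n (calH_compl (calH0W X))
  end.

Definition qsim (b c : calQ) : Prop :=
  match b, c with
  | QElt m _, QElt n _ => m = n
  | _, _ => False
  end.

Definition qell (b : calQ) : R :=
  match b with
  | QBot => 0
  | QTop => 1
  | QElt _ X => fine (lebesgue_measure (sval X))
  end.

Definition qIn (a : nat -> R) (b : calQ) : Prop :=
  match b with
  | QBot => False
  | QTop => True
  | QElt n X => sval X (a n)
  end.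

Definition hilbert_cube : set (nat -> R) := [set a | forall n, I01 (a n)].

Definition cube (C : set (nat -> R)) : Prop :=
  exists a b : nat -> R,
    [/\ C = [set x | forall n, `[a n, b n[%classic (x n)],
        C !=set0,
        C `<=` hilbert_cube &
        finite_set [set n | ~ (a n = 0 /\ b n = 1)]].

Record admissible (S : set (nat -> R)) : Prop := Admissible {
  adm_sub : S `<=` hilbert_cube;
  adm_card : (S #= [set: nat])%card;
  adm_cube : forall C, cube C -> (S `&` C) !=set0;
  adm_inj : set_inj (S `*` [set: nat]) (fun p => p.1 p.2) }.

Lemma cube_hilbert : cube hilbert_cube.
Proof.
exists (fun=> 0), (fun=> 1); split => //.
  by exists (fun=> 0) => n; rewrite /I01 /= in_itv /= lexx ltr01.
by rewrite (_ : [set _ | _] = set0)//; apply/seteqP; split => // n /=; apply.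
Qed.

Definition Mcar (S : set (nat -> R)) (s : sort) : Type :=
  match s with
  | SP => {a : nat -> R | S a}
  | SQ => calQ
  | SR => R
  end.

Lemma Mcar_inhabited (S : set (nat -> R)) :
  admissible S -> forall s, inhabited (Mcar S s).
Proof.
move=> hS [] /=.
- by have [a [Sa _]] := adm_cube hS cube_hilbert; exact: (inhabits (exist _ a Sa)).
- exact: (inhabits QBot).
- exact: (inhabits 0).
Qed.

Definition Mhalf (S : set (nat -> R)) (hS : admissible S) : structure :=
  @Structure (Mcar S) (Mcar_inhabited hS)
    (fun a b => qIn (sval a) b) qsim qell
    qcap qcup qcompl QBot QTop
    (fun x y : R => x + y) (fun x y : R => x < y) 0 1.

End HalfOpen.

(* Main.v *)
From HB Require Import structures.
From mathcomp Require Import all_boot all_order all_algebra.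
From mathcomp Require Import all_classical all_reals all_analysis.
From mathcomp Require Import ring lra.
Require Import Defs.

(* Everything is computed in M = Mhalf hS and transferred to the models of Th M
   through universal closures. A valuation of finitely many variables yields a
   configuration of points, elements of Q and reals. Its diagram is finite: which
   elements are in the same class or equal to the top, which points coincide or
   lie in which elements, and which atoms of the finite Boolean algebra generated
   by each class are nonempty. Its numerical part consists of the real variables
   and the measures of these atoms. Quantifier-free definable sets are exactly the
   Boolean combinations of conditions on the diagram and rational linear
   inequalities on the numerical part. This class is stable under projection: for
   a real by Ferrante-Rackoff elimination; for a point because S meets every cube,
   so that the diagram decides which one-point extensions exist; for an element
   because the measures of its traces on the atoms can be prescribed freely, up to
   linear inequalities and whatever finitely many points it must contain or avoid,
   so that the quantifier is replaced by finitely many real ones. *)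

Set Implicit Arguments.
Unset Strict Implicit.
Unset Printing Implicit Defensive.

Import Order.TTheory GRing.Theory Num.Theory.
Import numFieldNormedType.Exports.

Local Open Scope classical_set_scope.
Local Open Scope ring_scope.

(** * Semilinear predicates and real quantifiers *)

(** No symbol of the language gives the number of a class: only [~] compares classes, and bottom and
    top are in none. A class is therefore always named by an element lying in it, and a class
    without such an element sees only trivial sets. Two properties of the structure tie the finite
    and the numerical data together. A nonempty half-open set has positive measure, so that
    emptiness of an atom is a linear condition on its measure. Injectivity of $(a,n)\mapsto a(n)$ on
    $S\times\mathbb{N}$ keeps distinct points apart in every coordinate, so that the incidences of a
    new element with the points inside one atom can be prescribed independently. Predicates are
    handled as functions on configurations; syntax enters only when terms are put in normal form and
    when the resulting predicates are written as formulas again, where the absence of subtraction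
    and of rational multiples has to be compensated. *)

Section Semilinear.
Context {R : realType}.

(** Affine functions of the generators [G] with rational coefficients. Real coefficients would go
    beyond the language, whose terms only add and use [0] and [1]. *)
Inductive lin (X : Type) (G : (X -> R) -> Prop) : (X -> R) -> Prop :=
| lin_gen g : G g -> lin G g
| lin_one : lin G (fun=> 1)
| lin_add f g : lin G f -> lin G g -> lin G (fun x => f x + g x)
| lin_scale (q : rat) f : lin G f -> lin G (fun x => ratr q * f x).

Inductive semilin (X : Type) (F : (X -> Prop) -> Prop) (G : (X -> R) -> Prop) :
    (X -> Prop) -> Prop :=
| semilin_fact P : F P -> semilin F G P
| semilin_lt0 f : lin G f -> semilin F G (fun x => f x < 0)
| semilin_not P : semilin F G P -> semilin F G (fun x => ~ P x)
| semilin_and P Q : semilin F G P -> semilin F G Q ->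
    semilin F G (fun x => P x /\ Q x).

Section Closure.
Variables (X : Type) (F : (X -> Prop) -> Prop) (G : (X -> R) -> Prop).

Lemma lin_ext f g : f =1 g -> lin G f -> lin G g.
Proof. by move=> /funext ->. Qed.

Lemma lin_cst (q : rat) : lin G (fun=> ratr q).
Proof.
by apply: (lin_ext _ (lin_scale q (lin_one G))) => x; rewrite mulr1.
Qed.

Lemma lin0 : lin G (fun=> 0).
Proof. by apply: (lin_ext _ (lin_cst 0)) => x; rewrite rmorph0. Qed.

Lemma lin_opp f : lin G f -> lin G (fun x => - f x).
Proof.
by move=> lf; apply: (lin_ext _ (lin_scale (-1) lf)) => x; rewrite rmorphN1 mulN1r.
Qed.

Lemma lin_sub f g : lin G f -> lin G g -> lin G (fun x => f x - g x).
Proof. by move=> lf lg; exact: lin_add lf (lin_opp lg). Qed.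

Lemma lin_sum (T : finType) (U : {set T}) (f : T -> X -> R) :
  (forall t, lin G (f t)) -> lin G (fun x => \sum_(t in U) f t x).
Proof.
move=> lf; rewrite (_ : (fun x => _) = \sum_(t in U) f t); last first.
  by apply/funext => x; rewrite fct_sumE.
by elim/big_ind: _ => [|g h|t _]; [exact: lin0|exact: lin_add|exact: lf].
Qed.

Lemma semilin_ext P Q : (forall x, P x <-> Q x) -> semilin F G P -> semilin F G Q.
Proof. by move=> PQ; rewrite (_ : P = Q)//; apply/funext => x; exact/propext. Qed.

Lemma semilin_false : semilin F G (fun=> False).
Proof.
by apply: (semilin_ext _ (semilin_lt0 F (lin_one G))) => x; rewrite ltr10.
Qed.

Lemma semilin_cst (p : Prop) : semilin F G (fun=> p).
Proof.
have [Hp|Hp] := pselect p.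
  by apply: (semilin_ext _ (semilin_not semilin_false)) => x; split=> // _ [].
by apply: (semilin_ext _ semilin_false) => x; split=> [[]|/Hp].
Qed.

Lemma semilin_or P Q : semilin F G P -> semilin F G Q ->
  semilin F G (fun x => P x \/ Q x).
Proof.
move=> lP lQ; apply: (semilin_ext _ (semilin_not
  (semilin_and (semilin_not lP) (semilin_not lQ)))) => x.
by rewrite not_andE !notE.
Qed.

Lemma semilin_lt f g : lin G f -> lin G g -> semilin F G (fun x => f x < g x).
Proof.
move=> lf lg; apply: (semilin_ext _ (semilin_lt0 F (lin_sub lf lg))) => x.
by rewrite subr_lt0.
Qed.

Lemma semilin_le f g : lin G f -> lin G g -> semilin F G (fun x => f x <= g x).
Proof.
move=> lf lg; apply: (semilin_ext _ (semilin_not (semilin_lt lg lf))) => x.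
by rewrite leNgt; split => /negP.
Qed.

Lemma semilin_eq f g : lin G f -> lin G g -> semilin F G (fun x => f x = g x).
Proof.
move=> lf lg; apply: (semilin_ext _
  (semilin_and (semilin_le lf lg) (semilin_le lg lf))) => x.
by split => [[fg gf]|->//]; apply/eqP; rewrite eq_le fg gf.
Qed.

Lemma semilin_exfin (T : finType) (P : T -> X -> Prop) :
  (forall t, semilin F G (P t)) -> semilin F G (fun x => exists t, P t x).
Proof.
move=> lP.
have : semilin F G (fun x => exists2 t, t \in enum T & P t x).
  elim: (enum T) => [|t s IH].
    by apply: (semilin_ext _ semilin_false) => x; split => // -[].
  apply: (semilin_ext _ (semilin_or (lP t) IH)) => x; split.
    move=> [Pt|[u us Pu]]; first by exists t; rewrite ?mem_head.
    by exists u; rewrite // inE us orbT.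
  by move=> [u]; rewrite inE => /orP[/eqP->|us] Pu; [left|right; exists u].
apply: semilin_ext => x; split => -[t]; first by exists t.
by move=> Pt; exists t; rewrite ?mem_enum.
Qed.

Lemma semilin_forallfin (T : finType) (P : T -> X -> Prop) :
  (forall t, semilin F G (P t)) -> semilin F G (fun x => forall t, P t x).
Proof.
move=> lP; apply: (semilin_ext _ (semilin_not
  (semilin_exfin (fun t => semilin_not (lP t))))) => x.
by rewrite -forallNE; split => + t => /(_ t); rewrite notE.
Qed.

End Closure.

Lemma lin_pullback X X' (G : (X -> R) -> Prop) (G' : (X' -> R) -> Prop)
    (r : X -> X' -> Prop) :
  (forall g, G' g -> exists2 f, lin G f & forall x x', r x x' -> g x' = f x) ->
  forall g, lin G' g -> exists2 f, lin G f & forall x x', r x x' -> g x' = f x.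
Proof.
move=> rG g; elim=> {g} [g /rG//||f g _ [f1 lf1 e1] _ [g1 lg1 e2]|q f _ [f1 lf1 e1]].
- by exists (fun=> 1) => //; exact: lin_one.
- by exists (fun x => f1 x + g1 x); [exact: lin_add|move=> x x' h;
    rewrite (e1 x)// (e2 x)].
- by exists (fun x => ratr q * f1 x); [exact: lin_scale|move=> x x' h; rewrite (e1 x)].
Qed.

(** The relation [r] limits the pairs on which a generator has to be rewritten; when [r] fixes a
    diagram, every fact becomes a constant. *)
Lemma semilin_pullback X X' (F : (X -> Prop) -> Prop) (G : (X -> R) -> Prop)
    (F' : (X' -> Prop) -> Prop) (G' : (X' -> R) -> Prop) (r : X -> X' -> Prop) :
  (forall P, F' P -> exists2 Q, semilin F G Q & forall x x', r x x' -> P x' <-> Q x) ->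
  (forall g, G' g -> exists2 f, lin G f & forall x x', r x x' -> g x' = f x) ->
  forall P, semilin F' G' P ->
  exists2 Q, semilin F G Q & forall x x', r x x' -> P x' <-> Q x.
Proof.
move=> rF rG P; elim=> {P} [P /rF//|f /(lin_pullback rG)[g lg e]|P _ [Q lQ e]|].
- exists (fun x => g x < 0); first exact: semilin_lt0.
  by move=> x x' h; rewrite (e x).
- by exists (fun x => ~ Q x); [exact: semilin_not|move=> x x' h; rewrite (e x)].
- move=> P1 P2 _ [Q1 lQ1 e1] _ [Q2 lQ2 e2].
  exists (fun x => Q1 x /\ Q2 x); first exact: semilin_and.
  by move=> x x' h; rewrite (e1 x)// (e2 x).
Qed.

Lemma semilin_fiber (X : Type) (T : finType) (D : X -> T)
    (F : (X -> Prop) -> Prop) (G : (X -> R) -> Prop) (P : X -> Prop) :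
  (forall t, semilin F G (fun x => D x = t)) ->
  (forall t, exists2 Q, semilin F G Q & forall x, D x = t -> P x <-> Q x) ->
  semilin F G P.
Proof.
move=> lD lP.
suff : semilin F G (fun x => exists t, D x = t /\ P x).
  by apply: semilin_ext => x; split => [[t []]//|Px]; exists (D x).
apply: semilin_exfin => t; have [Q lQ e] := lP t.
apply: (semilin_ext _ (semilin_and (lD t) lQ)) => x.
by split => -[Dx H]; split => //; apply/(e _ Dx).
Qed.

(** * Elimination of one real variable *)

Definition same_cut (T : Type) (g : T -> R) (r r' : R) :=
  forall t, ((r < g t) = (r' < g t)) /\ ((g t < r) = (g t < r')).

Definition test_index (T : finType) : finType := (T * T + (T + T + unit))%type.

(** Midpoints of two values, the case [i = j] being the value itself; a point beyond each value on
    either side; and [0], for an empty family. *)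
Definition test_point (T : finType) (g : T -> R) (t : test_index T) : R :=
  match t with
  | inl (i, j) => 2^-1 * (g i + g j)
  | inr (inl (inl i)) => g i - 1
  | inr (inl (inr i)) => g i + 1
  | inr (inr _) => 0
  end.

(** If [r] is not a value of [g], its cut is determined by the nearest values below and above, where
    they exist. *)
Lemma test_pointP (T : finType) (g : T -> R) (r : R) :
  exists t, same_cut g r (test_point g t).
Proof.
have [[i gir]|ne] := pselect (exists i, g i = r).
  by exists (inl (i, i)) => j /=; rewrite (_ : 2^-1 * _ = r)//; lra.
have neq i : g i != r by apply/eqP => e; apply: ne; exists i.
have lower : (exists i, g i < r /\ forall j, g j < r -> g j <= g i) \/
             forall j, r < g j.
  have [[i0 gi0]|no] := pselect (exists i, g i < r).
    left; case: (@arg_maxP _ _ _ i0 (fun i => g i < r) g gi0) => i gi imax.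
    by exists i; split.
  right => j; rewrite lt_neqAle eq_sym neq leNgt; apply/negP => gj.
  by apply: no; exists j.
have upper : (exists i, r < g i /\ forall j, r < g j -> g i <= g j) \/
             forall j, g j < r.
  have [[i0 gi0]|no] := pselect (exists i, r < g i).
    left; case: (@arg_minP _ _ _ i0 (fun i => r < g i) g gi0) => i gi imin.
    by exists i; split.
  right => j; rewrite lt_neqAle neq leNgt; apply/negP => gj.
  by apply: no; exists j.
have dich j : (r < g j) = ~~ (g j < r) by rewrite -leNgt le_eqVlt eq_sym (negbTE (neq j)).
case: lower upper => [[l [lr lmax]]|Hl] [[u [ru umin]]|Hu].
- exists (inl (l, u)) => j /=.
  case: (ltP (g j) r) => gj.
    have := lmax _ gj => gjl.
    have -> : (r < g j) = false by lra.
    by split; symmetry; [apply/negbTE; rewrite -leNgt|]; lra.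
  have gj' : r < g j by rewrite dich -leNgt.
  have := umin _ gj' => ugj.
  by rewrite gj'; split; symmetry; [|apply/negbTE; rewrite -leNgt]; lra.
- exists (inr (inl (inr l))) => j /=.
  have gj := Hu j; have := lmax _ gj => gjl; rewrite gj.
  have -> : (r < g j) = false by lra.
  by split; symmetry; [apply/negbTE; rewrite -leNgt|]; lra.
- exists (inr (inl (inl u))) => j /=.
  have gj := Hl j; have := umin _ gj => ugj; rewrite gj.
  have -> : (g j < r) = false by lra.
  by split; symmetry; [|apply/negbTE; rewrite -leNgt]; lra.
- exists (inr (inr tt)) => j /=.
  by exfalso; move: (Hl j) (Hu j); lra.
Qed.

(* Ferrante-Rackoff elimination: the truth value of [P (h x r)] only depends on
   the position of [r] relative to finitely many linear functions of [x], so it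
   is enough to try one test point in each of the intervals that they delimit. *)
Lemma semilin_exR X X' (F : (X -> Prop) -> Prop) (G : (X -> R) -> Prop)
    (F' : (X' -> Prop) -> Prop) (G' : (X' -> R) -> Prop) (h : X -> R -> X') :
  (forall P, F' P -> exists2 Q, semilin F G Q & forall x r, P (h x r) <-> Q x) ->
  (forall g, G' g -> exists (q : rat) (f : X -> R),
     lin G f /\ forall x r, g (h x r) = f x + ratr q * r) ->
  forall P, semilin F' G' P -> semilin F G (fun x => exists r, P (h x r)).
Proof.
move=> hF hG P lP.
have {}hG g : lin G' g -> exists (q : rat) (f : X -> R),
    lin G f /\ forall x r, g (h x r) = f x + ratr q * r.
  elim=> {g} [g /hG//||f g _ [q1 [f1 [lf1 e1]]] _ [q2 [f2 [lf2 e2]]]|].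
  - exists 0, (fun=> 1); split; first exact: lin_one.
    by move=> x r; rewrite rmorph0 mul0r addr0.
  - exists (q1 + q2), (fun x => f1 x + f2 x); split; first exact: lin_add.
    by move=> x r; rewrite e1 e2 rmorphD/=; lra.
  - move=> q f _ [q1 [f1 [lf1 e1]]].
    exists (q * q1), (fun x => ratr q * f1 x); split; first exact: lin_scale.
    by move=> x r; rewrite e1 rmorphM/= mulrDr mulrA.
have [T [g [lg gcut lsub]]] : exists (T : finType) (g : T -> X -> R),
    [/\ forall t, lin G (g t),
        forall x r r', same_cut (g^~ x) r r' -> P (h x r) <-> P (h x r') &
        forall l, lin G l -> semilin F G (fun x => P (h x (l x)))].
  elim: lP => {P} [P FP|f lf|P _ [T [g [lg gcut lsub]]]|].
  - have [Q lQ e] := hF _ FP; exists void, (fun _ _ => 0); split => //.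
    + by move=> x r r' _; rewrite !e.
    + by move=> l _; apply: (semilin_ext _ lQ) => x; rewrite e.
  - have [q [f1 [lf1 e]]] := hG _ lf.
    (* The sign of [f1 x + q r] changes at [r = - q^-1 f1 x]. For [q = 0] the inverse is [0] by
       convention, and any value will do since the sign does not depend on [r]. *)
    exists unit, (fun _ x => ratr (- q^-1) * f1 x); split.
    + by move=> _; exact: lin_scale.
    + move=> x r r' /(_ tt) /=; rewrite !e rmorphN fmorphV/=.
      have [->|q0] := eqVneq q 0; first by rewrite rmorph0 !mul0r.
      have eqr s : f1 x + ratr q * s = ratr q * (s - - (ratr q)^-1 * f1 x).
        by rewrite mulrBr mulNr mulrN mulVKf ?fmorph_eq0// opprK addrC.
      rewrite !eqr => -[eq1 eq2].
      have [qp|qn] := ltP 0 q.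
        by rewrite !pmulr_rlt0 ?ltr0q// !subr_lt0 eq1.
      have qn' : ratr q < 0 :> R by rewrite ltrq0 lt_neqAle q0.
      by rewrite !(nmulr_rlt0 _ qn') !subr_gt0 eq2.
    + move=> l ll; apply: (semilin_ext _ (semilin_lt0 F
        (lin_add lf1 (lin_scale q ll)))) => x.
      by rewrite e.
  - exists T, g; split => // [x r r' /gcut->//|l ll].
    exact/semilin_not/lsub.
  - move=> P1 P2 _ [T1 [g1 [lg1 gcut1 lsub1]]] _ [T2 [g2 [lg2 gcut2 lsub2]]].
    exists (T1 + T2)%type,
      (fun t => match t with inl t => g1 t | inr t => g2 t end); split.
    + by case.
    + move=> x r r' H.
      by rewrite (gcut1 x r r') ?(gcut2 x r r')// => t;
        [exact: (H (inr t))|exact: (H (inl t))].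
    + by move=> l ll; apply: semilin_and; [exact: lsub1|exact: lsub2].
have ltest t : lin G (fun x => test_point (g^~ x) t).
  case: t => [[i j]|[[i|i]|[]]] /=.
  - apply: (lin_ext _ (lin_scale 2^-1 (lin_add (lg i) (lg j)))) => x.
    by rewrite fmorphV/= ratr_nat.
  - exact: lin_sub (lg i) (lin_one G).
  - exact: lin_add (lg i) (lin_one G).
  - exact: lin0.
apply: (semilin_ext _ (semilin_exfin (fun t => lsub _ (ltest t)))) => x.
split => [[t Pt]|[r Pr]]; first by exists (test_point (g^~ x) t).
by have [t /gcut/iffLR] := test_pointP (g^~ x) r => /(_ Pr); exists t.
Qed.

(** * Elimination of finitely many real variables *)

Section RealVectors.
Variables (X : Type) (F : (X -> Prop) -> Prop) (G : (X -> R) -> Prop).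
Variable J : finType.

Definition fst_facts : (X * (J -> R) -> Prop) -> Prop :=
  fun P => exists2 Q, F Q & P = fun z => Q z.1.

Definition vec_gens (s : seq J) : (X * (J -> R) -> R) -> Prop :=
  fun g => (exists2 f, G f & g = fun z => f z.1) \/
           (exists2 j, j \in s & g = fun z => z.2 j).

(** Induction on the list of coordinates that may still occur: the head coordinate is overwritten by
    [upd] and eliminated as one real variable, which leaves a predicate in the others. *)
Lemma semilin_exRn P : semilin fst_facts (vec_gens (enum J)) P ->
  semilin F G (fun x => exists y, P (x, y)).
Proof.
elim: (enum J) P => [|j s IH] P lP.
  have [||Q lQ e] := semilin_pullback (F := F) (G := G)
      (r := fun x z => x = z.1) _ _ lP.
  - by move=> _ [Q FQ ->]; exists Q; [exact: semilin_fact|move=> x x' ->].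
  - by move=> _ [[f Gf ->]|[]//]; exists f; [exact: lin_gen|move=> x x' ->].
  apply: (semilin_ext _ lQ) => x; split => [Qx|[y /e]]; last exact.
  by exists (fun=> 0); apply/(e x).
pose upd (z : X * (J -> R)) r : X * (J -> R) :=
  (z.1, fun i => if i == j then r else z.2 i).
have : semilin fst_facts (vec_gens s) (fun z => exists r, P (upd z r)).
  apply: (semilin_exR (h := upd) _ _ lP).
    move=> _ [Q FQ ->]; exists (fun z => Q z.1) => //.
    by apply: semilin_fact; exists Q.
  move=> _ [[f Gf ->]|[i ijs ->]].
    exists 0, (fun z => f z.1); split; first by apply: lin_gen; left; exists f.
    by move=> z r; rewrite rmorph0 mul0r addr0.
  have [->|ij] := eqVneq i j.
    exists 1, (fun=> 0); split; first exact: lin0.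
    by move=> z r; rewrite /= eqxx rmorph1 mul1r add0r.
  exists 0, (fun z => z.2 i); split.
    by apply: lin_gen; right; exists i => //; move: ijs; rewrite inE (negbTE ij).
  by move=> z r; rewrite /= (negbTE ij) rmorph0 mul0r addr0.
move=> /IH; apply: semilin_ext => x; split => [[y [r Pr]]|[y Py]].
  by exists (upd (x, y) r).2.
exists y, (y j); rewrite (_ : upd _ _ = (x, y))//; congr pair.
by apply/funext => i; case: eqVneq => // ->.
Qed.

End RealVectors.
End Semilinear.

(** * Measures of half-open sets *)

Section HalfOpenSets.
Context {R : realType}.
Local Notation I01 := (@I01 R).
Implicit Types (X Y : set R) (x y u w : R).

Lemma I01E x : I01 x = (0 <= x < 1) :> Prop.
Proof. by rewrite /I01 /= in_itv. Qed.

Lemma calH_sub X : calH X -> X `<=` I01.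
Proof.
elim=> {X} [a b a0 ab b1 x| x [] | x // |X Y _ XI _ YI x [/XI]|X Y _ XI _ YI x
  [/XI|/YI]|X _ _ x []]//.
rewrite I01E /= in_itv/= => /andP[ax xb]; lra.
Qed.

Lemma calH_measurable X : calH X -> measurable X.
Proof.
elim=> {X} [a b _ _ _||| X Y _ mX _ mY|X Y _ mX _ mY|X _ mX].
- exact: measurable_itv.
- exact: measurable0.
- exact: measurable_itv.
- exact: measurableI.
- exact: measurableU.
- by apply: measurableD => //; exact: measurable_itv.
Qed.

Lemma calH_diff X Y : calH X -> calH Y -> calH (X `\` Y).
Proof.
move=> hX hY; rewrite (_ : _ `\` _ = X `&` (I01 `\` Y)).
  exact/calH_cap/calH_compl.
apply/seteqP; split=> x [Xx]; last by move=> [].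
by move=> nYx; split=> //; split=> //; exact: calH_sub Xx.
Qed.

Lemma calH_itvI u w X : 0 <= u -> u < w -> w <= 1 -> calH X -> calH (X `&` `[u, w[).
Proof. by move=> u0 uw w1 hX; apply: calH_cap => //; exact: calH_itv. Qed.

(** Membership is constant immediately to the right of each point: this holds for half-open
    intervals and survives Boolean operations. It replaces a normal form as a finite union of
    intervals. *)
Lemma calH_locally_constant X x : calH X -> I01 x -> exists e : R,
  [/\ 0 < e, x + e <= 1 & forall y, x <= y < x + e -> X y <-> X x].
Proof.
move=> + /[!I01E] x01; elim=> {X} [a b a0 ab b1|||X Y _ [e [e0 xe He]] _ [f [f0 xf
  Hf]]|X Y _ [e [e0 xe He]] _ [f [f0 xf Hf]]|X _ [e [e0 xe He]]].
- have [xa|ax] := ltP x a.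
    exists (a - x); split; [lra|lra|move=> y xy]; rewrite /= !in_itv/=.
    by split => /andP[]; lra.
  have [xb|bx] := ltP x b.
    exists (b - x); split; [lra|lra|move=> y xy]; rewrite /= !in_itv/=.
    by split => _; apply/andP; split; lra.
  exists (1 - x); split; [lra|lra|move=> y xy]; rewrite /= !in_itv/=.
  by split => /andP[]; lra.
- by exists (1 - x); split=> //; lra.
- exists (1 - x); split; [lra|lra|move=> y xy]; rewrite !I01E.
  by split => _; lra.
- exists (Num.min e f); split; first by rewrite lt_min e0.
    by apply: le_trans xe; rewrite lerD2l ge_min lexx.
  move=> y /andP[xy]; rewrite -ltrBlDl lt_min => /andP[ye yf].
  by rewrite /setI /=; rewrite He ?Hf//; lra.
- exists (Num.min e f); split; first by rewrite lt_min e0.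
    by apply: le_trans xe; rewrite lerD2l ge_min lexx.
  move=> y /andP[xy]; rewrite -ltrBlDl lt_min => /andP[ye yf].
  by rewrite /setU /=; rewrite He ?Hf//; lra.
- exists e; split => // y xy; rewrite /setD /=; rewrite He// !I01E.
  by split => -[_ nX]; split => //; lra.
Qed.

Lemma calH_contains_itv X x : calH X -> X x -> exists e : R,
  [/\ 0 < e, x + e <= 1 & `[x, x + e[ `<=` X].
Proof.
move=> hX Xx; have [e [e0 xe He]] := calH_locally_constant hX (calH_sub hX Xx).
by exists e; split=> // y; rewrite /= in_itv/= => /He ->.
Qed.

Definition mu X : R := fine (lebesgue_measure X).

Lemma mu_itv u w : u <= w -> mu `[u, w[ = w - u.
Proof.
rewrite /mu lebesgue_measure_itv /= lte_fin => uw.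
by case: ltgtP uw => // -> _; rewrite subrr.
Qed.

Lemma mu0 : mu set0 = 0.
Proof. by rewrite /mu measure0. Qed.

Lemma mu_I01 : mu (I01) = 1.
Proof. by rewrite /I01 mu_itv// subr0. Qed.

Lemma mu_fin X : calH X -> lebesgue_measure X \is a fin_num.
Proof.
move=> hX; rewrite ge0_fin_numE//.
apply: (@le_lt_trans _ _ (lebesgue_measure (I01))).
  by apply: le_measure; rewrite ?inE;
    [exact: calH_measurable|exact: measurable_itv|exact: calH_sub].
by rewrite /I01 lebesgue_measure_itv/= lte_fin ltr01 -EFinB ltry.
Qed.

Lemma mu_ge0 X : 0 <= mu X.
Proof. exact: fine_ge0. Qed.

Lemma mu_le X Y : calH X -> calH Y -> X `<=` Y -> mu X <= mu Y.
Proof.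
move=> hX hY XY; apply: fine_le; [exact: mu_fin|exact: mu_fin|].
by apply: le_measure; rewrite ?inE//; exact: calH_measurable.
Qed.

Lemma mu_disjU X Y : calH X -> calH Y -> X `&` Y = set0 ->
  mu (X `|` Y) = mu X + mu Y.
Proof.
move=> hX hY XY; rewrite /mu measureU//; try exact: calH_measurable.
by rewrite fineD//; exact: mu_fin.
Qed.

Lemma mu_setID X Y : calH X -> calH Y -> mu X = mu (X `&` Y) + mu (X `\` Y).
Proof.
move=> hX hY; rewrite -mu_disjU ?setUIDK//.
- exact: calH_cap.
- exact: calH_diff.
- by apply/seteqP; split=> x // [[_ Yx] []].
Qed.

(** A nonempty half-open set contains an interval of positive length. This makes emptiness of atoms
    visible in their measures. *)
Lemma mu_gt0 X : calH X -> 0 < mu X <-> X !=set0.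
Proof.
move=> hX; split=> [|[x Xx]].
  by apply: contraPP => /set0P/negP/negPn/eqP ->; rewrite mu0 ltxx.
have [e [e0 xe sub]] := calH_contains_itv hX Xx.
have /= := calH_sub hX Xx; rewrite I01E => x01.
apply: (@lt_le_trans _ _ (mu `[x, x + e[)); first by rewrite mu_itv; lra.
by apply: mu_le => //; apply: calH_itv; lra.
Qed.

(** * Half-open sets with prescribed measure and prescribed points *)

Lemma avoid_right (x : R) (s : seq R) (d : R) : x \notin s -> 0 < d ->
  exists e, [/\ 0 < e, e <= d & forall y, y \in s -> ~ (x <= y < x + e)].
Proof.
move=> + d0; elim: s => [_|y s IH]; first by exists d.
rewrite inE negb_or => /andP[xy /IH[e [e0 ed He]]].
have [yx|{}xy] : y < x \/ x < y by apply/orP; rewrite -neq_lt eq_sym.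
  exists e; split=> // z; rewrite inE => /orP[/eqP->|/He//]; lra.
exists (Num.min e (y - x)); split.
- by rewrite lt_min e0/=; lra.
- by rewrite ge_min ed.
- move=> z; rewrite inE => /orP[/eqP->|/He h] /andP[xz];
    rewrite -ltrBlDl lt_min => /andP[h1 h2]; first lra.
  by apply: h; lra.
Qed.

(** The interval is halved once for each point to be avoided, since a point lies in at most one of
    the two halves. *)
Lemma avoid_itv (u w : R) (s : seq R) : u < w -> exists u' w',
  [/\ u <= u', u' < w', w' <= w & forall y, y \in s -> ~ (u' <= y < w')].
Proof.
move=> uw; elim: s => [|y s [a [b [ua ab bw H]]]]; first by exists u, w.
have [yb|by_] := ltP y ((a + b) / 2).
  exists ((a + b) / 2), b; split; [lra|lra|lra|move=> z].
  by rewrite inE => /orP[/eqP->|/H]; lra.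
exists a, ((a + b) / 2); split; [lra|lra|lra|move=> z].
by rewrite inE => /orP[/eqP->|/H]; lra.
Qed.

(** Each point of [ins] receives a short interval to its right: the cover of the remaining points
    gets half of the allowed measure, the interval at most the other half. *)
Lemma small_cover (ins outs : seq R) (d : R) : 0 < d ->
  (forall x, x \in ins -> I01 x) -> (forall x, x \in ins -> x \notin outs) ->
  exists E, [/\ calH E, mu E < d, forall x, x \in ins -> E x &
                forall x, x \in outs -> ~ E x].
Proof.
elim: ins d => [|x s IH] d d0 I01s dis.
  by exists set0; split; [exact: calH_set0|rewrite mu0|move=> x|move=> x _ []].
have d20 : 0 < d / 2 by lra.
have [||E [hE Ed insE outsE]] := IH _ d20.
- by move=> y ys; apply: I01s; rewrite inE ys orbT.
- by move=> y ys; apply: dis; rewrite inE ys orbT.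
have := I01s x (mem_head _ _); rewrite I01E => x01.
(* The bound [1 - x] keeps the interval inside $[0,1)$. *)
have d'0 : 0 < Num.min (d / 2) (1 - x) by rewrite lt_min d20 subr_gt0; lra.
have [e [e0 ed He]] := avoid_right (dis _ (mem_head _ _)) d'0.
move: ed; rewrite le_min => /andP[ed e1].
have hI : calH `[x, x + e[ by apply: calH_itv; lra.
exists (E `|` `[x, x + e[); split.
- exact: calH_cup.
- rewrite setUC; have -> : `[x, x + e[ `|` E = `[x, x + e[ `|` (E `\` `[x, x + e[).
    apply/seteqP; split=> y; last by move=> [|[]]; [left|right].
    by have [|] := pselect (`[x, x + e[%classic y) => h; [left|move=> [//|Ey]; right].
  rewrite mu_disjU//; [|exact: calH_diff|by apply/seteqP; split=> y // [? []]].
  rewrite mu_itv; last lra.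
  have : mu (E `\` `[x, x + e[) <= mu E.
    by apply: mu_le => //; exact: calH_diff.
  lra.
- move=> y; rewrite inE => /orP[/eqP->|/insE]; last by left.
  by right; rewrite /= in_itv/= lexx/=; lra.
- by move=> y ys [/outsE//|]; rewrite /= in_itv/=; exact: He.
Qed.

Lemma calH_cut X t : calH X -> 0 <= t <= 1 -> calH (X `&` `[0, t[).
Proof.
move=> hX /andP[t0 t1]; have [->|tn0] := eqVneq t 0.
  by rewrite set_itvxx setI0; exact: calH_set0.
by apply: calH_itvI => //; rewrite lt_neqAle eq_sym tn0.
Qed.

Lemma mu_cut_lip X s t : calH X -> 0 <= s -> s <= t -> t <= 1 ->
  mu (X `&` `[0, s[) <= mu (X `&` `[0, t[) <= mu (X `&` `[0, s[) + (t - s).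
Proof.
move=> hX s0 st t1.
have hs : calH (X `&` `[0, s[) by apply: calH_cut => //; lra.
have ht : calH (X `&` `[0, t[) by apply: calH_cut => //; lra.
have sub : X `&` `[0, s[ `<=` X `&` `[0, t[.
  by move=> x [Xx]; rewrite /= in_itv/= => xs; split=> //=; rewrite in_itv/=; lra.
apply/andP; split; first exact: mu_le.
have [->|nst] := eqVneq s t; first by rewrite subrr addr0.
have st' : s < t by rewrite lt_neqAle nst.
have hI : calH `[s, t[ by apply: calH_itv; lra.
rewrite (mu_setID ht hs) (setIidr sub) lerD2l -mu_itv//.
apply: mu_le => //; first exact: calH_diff.
move=> x [[Xx]]; rewrite /= !in_itv/= => xt nxs; rewrite leNgt.
have [xs|] := ltP x s; last lra.
by exfalso; apply: nxs; split => //; lra.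
Qed.

(** The measure of the part of [X] below [t] is a 1-Lipschitz function of [t], and the intermediate
    value theorem applies. *)
Lemma mu_cut_onto X v : calH X -> 0 <= v <= mu X ->
  exists2 t, 0 <= t <= 1 & mu (X `&` `[0, t[) = v.
Proof.
(* Clamping extends this function to the whole real line, so that the end points need no separate
   treatment. *)
move=> hX v01; pose clamp (t : R) := if t < 0 then 0 else if 1 < t then 1 else t.
have clampI t : 0 <= clamp t <= 1.
  by rewrite /clamp; case: (ltP t 0) => h1; case: (ltP 1 t) => h2; lra.
have clamp_le s t : s <= t -> clamp s <= clamp t <= clamp s + (t - s).
  rewrite /clamp => st.
  by case: (ltP t 0) => h1; case: (ltP 1 t) => h2; case: (ltP s 0) => h3;
    case: (ltP 1 s) => h4; lra.
pose g t := mu (X `&` `[0, clamp t[).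
have g_lip s t : s <= t -> `|g t - g s| <= `|t - s|.
  move=> st; have /andP[c1 c2] := clamp_le _ _ st.
  have /andP[s0 _] := clampI s; have /andP[_ t1] := clampI t.
  have /andP[g1 g2] := mu_cut_lip hX s0 c1 t1.
  by rewrite !ger0_norm ?subr_ge0//; rewrite /g; lra.
have cg : continuous g.
  move=> x; apply/cvgrPdist_lt => e e0; near=> y.
  apply: (@le_lt_trans _ _ `|x - y|).
    have [xy|/ltW xy] := leP x y; last exact: g_lip.
    by rewrite distrC (distrC x); exact: g_lip.
  by near: y; apply: (@cvgr_dist_lt _ _ _ (nbhs x) _ id x).
have g0 : g 0 = 0.
  rewrite /g (_ : clamp 0 = 0) ?set_itvxx ?setI0 ?mu0//.
  by rewrite /clamp ltxx ltr10.
have g1 : g 1 = mu X.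
  rewrite /g (_ : clamp 1 = 1); first by rewrite setIidl//; exact: calH_sub.
  by rewrite /clamp ltr10 ltxx.
have [||c _ <-] := @IVT R g 0 1 v ler01.
- exact: continuous_subspaceT.
- by rewrite g0 g1 min_l ?max_r ?mu_ge0.
by exists (clamp c).
Unshelve. all: by end_near.
Qed.

(* The points of [ins] and [outs] are first covered by disjoint sets of small
   measure; a cut of the rest then adjusts the total measure to [v]. *)
Lemma calH_split Y (ins outs : seq R) v : calH Y -> 0 < v < mu Y ->
  (forall x, x \in ins -> Y x) -> (forall x, x \in outs -> Y x) ->
  (forall x, x \in ins -> x \notin outs) ->
  exists X, [/\ calH X, X `<=` Y, mu X = v, forall x, x \in ins -> X x &
                forall x, x \in outs -> ~ X x].
Proof.
move=> hY /andP[v0 vY] insY outsY dis.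
have [|E [hE Ev insE outsE]] := small_cover (ins := ins) (outs := outs) v0 _ dis.
  by move=> x /insY; exact: calH_sub.
(* [E'] must cost less than [mu Y - v]: then [B] keeps more than [v - mu A], and the cut below can
   bring the total to [v]. *)
have d0 : 0 < mu Y - v by lra.
have [||E' [hE' Ev' outsE' _]] := small_cover (ins := outs) (outs := [::]) d0.
- by move=> x /outsY; exact: calH_sub.
- by [].
pose A := Y `&` E; have hA : calH A by exact: calH_cap.
pose B := Y `\` (E `|` E').
have hB : calH B by apply: calH_diff => //; exact: calH_cup.
have muA : mu A <= mu E by apply: mu_le => // x [].
have muB : mu Y <= mu A + mu B + mu E'.
  have hC : calH (Y `&` (E' `\` E)) by apply: calH_cap => //; exact: calH_diff.
  have -> : Y = A `|` (B `|` (Y `&` (E' `\` E))).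
    apply/seteqP; split=> x; last by move=> [[]|[[]|[]]].
    move=> Yx; have [Ex|nE] := pselect (E x); first by left.
    have [Ex|nE'] := pselect (E' x); first by right; right.
    by right; left; split => // -[].
  rewrite mu_disjU//; [|exact: calH_cup|]; last first.
    by apply/seteqP; split=> x // [[? Ex] [[_ []]|[_ []]//]]; left.
  rewrite mu_disjU//; last first.
    by apply/seteqP; split=> x // [[_ nE] [_ [E'x _]]]; apply: nE; right.
  have : mu (Y `&` (E' `\` E)) <= mu E' by apply: mu_le => // x [_ []].
  lra.
have [|t t01 tB] := @mu_cut_onto B (v - mu A) hB; first lra.
have hBt := calH_cut hB t01.
exists (A `|` (B `&` `[0, t[)); split.
- exact: calH_cup.
- by move=> x [[]|[[]]].
- rewrite mu_disjU// ?tB; first lra.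
  by apply/seteqP; split=> x // [[_ Ex] [[_ nE] _]]; apply: nE; left.
- by move=> x xi; left; split; [exact: insY|exact: insE].
- by move=> x xo [[_ /(outsE _ xo)]|[[_ nE] _]]//; apply: nE; right; exact: outsE'.
Qed.

End HalfOpenSets.

(** * Elements of Q and masks *)

Section Elements.
Context {R : realType}.
Local Notation I01 := (@I01 R).
Implicit Types (q : calQ R) (k : option nat) (X Y : set R).

Lemma I01_0 : I01 0.
Proof. by rewrite I01E; apply/andP; split. Qed.

Lemma I01_neq0 : I01 <> set0.
Proof. by move=> e; have := I01_0; rewrite e. Qed.

Definition cls q : option nat := if q is QElt n _ then Some n else None.

(* The set represented by [q] relative to the class [k]; elements of other
   classes count as empty. *)
Definition setn k q : set R :=
  match q with
  | QBot => set0
  | QTop => I01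
  | QElt n X => if Some n == k then sval X else set0
  end.

Lemma calH_setn k q : calH (setn k q).
Proof.
case: q => [||n X] /=; [exact: calH_set0|exact: calH_I01|].
by case: ifP => _; [exact: calH0W|exact: calH_set0].
Qed.

Lemma setn_cls n (X : {X : set R | calH0 X}) : setn (Some n) (QElt n X) = sval X.
Proof. by rewrite /= eqxx. Qed.

Lemma setn_other k q : k = None \/ cls q <> k ->
  forall x, I01 x -> setn k q x <-> q = QTop R.
Proof.
case: q => [||n X] //= h x Ix.
rewrite (_ : (Some n == k) = false); first by split.
by apply/eqP => e; case: h => h; [rewrite h in e|apply: h].
Qed.

(** Converse of [setn]. Unlike [qpair] it takes no membership proof, so that its set argument can be
    rewritten; a pair that represents no element goes to [QBot]. *)
Definition qmk k X : calQ R :=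
  if pselect (X = I01) then QTop R else
  match k, pselect (calH0 X) with
  | Some n, left h => QElt n (exist _ X h)
  | _, _ => QBot R
  end.

Lemma qmk_set0 k : qmk k set0 = QBot R.
Proof.
rewrite /qmk; case: (pselect (set0 = I01)) => [e|ne]; first by case: I01_neq0.
by case: k => // n; case: (pselect (calH0 set0)) => [h|//]; case: (h).
Qed.

Lemma qmk_I01 k : qmk k I01 = QTop R.
Proof. by rewrite /qmk; case: (pselect (I01 = I01)). Qed.

Lemma qmk_Elt n (X : {X : set R | calH0 X}) : qmk (Some n) (sval X) = QElt n X.
Proof.
case: X => X h; rewrite /qmk /=; case: (pselect (X = I01)) => [e|ne]; first by case: h.
by case: (pselect (calH0 X)) => [h'|//]; rewrite (Prop_irrelevance h h').
Qed.

Lemma qmk_cls q : qmk (cls q) (setn (cls q) q) = q.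
Proof.
by case: q => [||n X]; [exact: qmk_set0|exact: qmk_I01|rewrite setn_cls qmk_Elt].
Qed.

Lemma qpair_qmk n X (hX : calH X) : qpair n hX = qmk (Some n) X.
Proof.
rewrite /qpair; case: (pselect (X = set0)) => [->|X0]; first by rewrite qmk_set0.
case: (pselect (X = I01)) => [->|X1]; first by rewrite qmk_I01.
by rewrite (qmk_Elt _ (exist _ X (And3 hX X0 X1))).
Qed.

Lemma qmk_eltP n X : calH X -> X <> set0 -> X <> I01 ->
  exists2 X' : {X : set R | calH0 X}, sval X' = X & qmk (Some n) X = QElt n X'.
Proof.
move=> hX X0 X1; exists (exist _ X (And3 hX X0 X1)) => //.
exact: (qmk_Elt n (exist _ X (And3 hX X0 X1))).
Qed.

Lemma qcompl_qmk n X : calH X -> qcompl (qmk (Some n) X) = qmk (Some n) (I01 `\` X).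
Proof.
move=> hX; have [->|X0] := pselect (X = set0).
  by rewrite setD0 qmk_set0 qmk_I01.
have [->|X1] := pselect (X = I01); first by rewrite setDv qmk_set0 qmk_I01.
by have [X' <- ->] := qmk_eltP n hX X0 X1; rewrite /= qpair_qmk.
Qed.

Lemma qcap_qmk n X Y : calH X -> calH Y ->
  qcap (qmk (Some n) X) (qmk (Some n) Y) = qmk (Some n) (X `&` Y).
Proof.
move=> hX hY; have [->|X0] := pselect (X = set0).
  by rewrite set0I qmk_set0.
have [->|X1] := pselect (X = I01).
  rewrite qmk_I01 (setIidr (calH_sub hY)).
  by case: (qmk _ _).
have [X' eX ->] := qmk_eltP n hX X0 X1.
have [->|Y0] := pselect (Y = set0); first by rewrite setI0 qmk_set0.
have [->|Y1] := pselect (Y = I01).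
  by rewrite qmk_I01 (setIidl (calH_sub hX)) -eX qmk_Elt.
have [Y' <- ->] := qmk_eltP n hY Y0 Y1.
by rewrite /= eqxx qpair_qmk eX.
Qed.

Lemma I01_setDK X : calH X -> I01 `\` (I01 `\` X) = X.
Proof. by move=> hX; rewrite setDD setIidr//; exact: calH_sub. Qed.

Lemma qcomplK : involutive (@qcompl R).
Proof.
case=> [||n X] //=; have hX := calH0W X.
by rewrite qpair_qmk (qcompl_qmk n (calH_compl hX)) I01_setDK// qmk_Elt.
Qed.

Lemma qcap_top q : (qcap (QTop R) q = q) * (qcap q (QTop R) = q).
Proof. by case: q. Qed.

Lemma qcap_bot q : (qcap (QBot R) q = QBot R) * (qcap q (QBot R) = QBot R).
Proof. by case: q. Qed.

(** De Morgan, so that only meets and complements need normal forms. For distinct classes the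
    complements still have distinct classes and meet in bottom, which agrees with a join equal to
    top. *)
Lemma qcup_qcompl q q' : qcup q q' = qcompl (qcap (qcompl q) (qcompl q')).
Proof.
case: q => [||n X].
- by rewrite [qcompl (QBot R)]/= qcap_top qcomplK; case: q'.
- by rewrite [qcompl (QTop R)]/= qcap_bot; case: q'.
case: q' => [||m Y].
- by rewrite [qcompl (QBot R)]/= qcap_top qcomplK.
- by rewrite [qcompl (QTop R)]/= qcap_bot.
have hX := calH0W X; have hY := calH0W Y.
have [X' eX' eX] : exists2 X' : {X : set R | calH0 X}, sval X' = I01 `\` sval X &
    qcompl (QElt n X) = QElt n X'.
  rewrite /= qpair_qmk; apply: qmk_eltP; first exact: calH_compl.
    move=> e; case: (svalP X) => _ _; apply.
    by rewrite -(I01_setDK hX) e setD0.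
  move=> e; case: (svalP X) => _ + _; apply.
  by rewrite -(I01_setDK hX) e setDv.
have [Y' eY' eY] : exists2 X' : {X : set R | calH0 X}, sval X' = I01 `\` sval Y &
    qcompl (QElt m Y) = QElt m X'.
  rewrite /= qpair_qmk; apply: qmk_eltP; first exact: calH_compl.
    move=> e; case: (svalP Y) => _ _; apply.
    by rewrite -(I01_setDK hY) e setD0.
  move=> e; case: (svalP Y) => _ + _; apply.
  by rewrite -(I01_setDK hY) e setDv.
rewrite eX eY /=; have [nm|//] := eqVneq n m.
rewrite !qpair_qmk qcompl_qmk; last by apply: calH_cap; exact: calH0W.
by rewrite eX' eY' setDIr !I01_setDK.
Qed.

Lemma qsim_cls q q' : qsim q q' <-> exists n, cls q = Some n /\ cls q' = Some n.
Proof.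
case: q => [||n X]; case: q' => [||m Y] /=; try by split=> // -[? []].
split=> [->|[p [[e1] [e2]]]]; first by exists m.
by rewrite e1 e2.
Qed.

Lemma qIn_cls n (a : nat -> R) q : cls q = Some n -> qIn a q <-> setn (Some n) q (a n).
Proof. by case: q => //= m X [->]; rewrite eqxx. Qed.

Lemma qIn_triv (a : nat -> R) q : cls q = None -> qIn a q <-> q = QTop R.
Proof. by case: q. Qed.

(** * Atoms of the algebra generated by one class *)

Section Masks.
Variable B : finType.
Implicit Types (b : B -> calQ R) (U : {set {ffun B -> bool}}).

(** A mask records which of the sets of class [k] contain [x]. Masks thus index the atoms of the
    algebra that these sets generate, and [cell] is a union of atoms. *)
Definition mask b k (x : R) : {ffun B -> bool} := [ffun j => `[< setn k (b j) x >]].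

Definition cell b k U : set R := [set x | I01 x /\ mask b k x \in U].

Lemma maskP b k x m : mask b k x = m <-> forall j, setn k (b j) x <-> m j.
Proof.
split=> [<- j|H]; first by rewrite ffunE; split => /asboolP.
by apply/ffunP => j; rewrite ffunE; apply/asboolP/idP => /H.
Qed.

Lemma calH_bigI (s : seq B) (f : B -> set R) : (forall j, calH (f j)) ->
  calH (I01 `&` \big[setI/setT]_(j <- s) f j).
Proof.
move=> hf; elim: s => [|j s IH]; rewrite ?big_nil ?setIT; first exact: calH_I01.
by rewrite big_cons setICA; apply: calH_cap.
Qed.

Lemma calH_cell b k U : calH (cell b k U).
Proof.
have h1 m : calH (cell b k [set m]%SET).
  rewrite (_ : cell _ _ _ = I01 `&` \big[setI/setT]_(j <- enum B)
      (if m j then setn k (b j) else I01 `\` setn k (b j))).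
    apply: calH_bigI => j; case: ifP => _; first exact: calH_setn.
    exact/calH_compl/calH_setn.
  rewrite -bigcap_seq; apply/seteqP; split=> x [Ix].
    rewrite inE => /eqP/maskP H; split => // j _ /=.
    by case: ifP => mj; [exact/H|split=> // /H; rewrite mj].
  move=> H; split => //; rewrite inE; apply/eqP/maskP => j.
  have := H j; rewrite /= mem_enum => /(_ isT).
  by case: ifP => _ h; split => //; case: h.
have -> : cell b k U = \big[setU/set0]_(m in U) cell b k [set m]%SET.
  rewrite -bigcup_pred; apply/seteqP; split=> x.
    by move=> [Ix xU]; exists (mask b k x) => //; split => //; rewrite inE.
  by move=> [m /= mU [Ix]]; rewrite inE => /eqP e; split=> //; rewrite e.
elim/big_ind: _ => [|X Y|m _]; [exact: calH_set0|exact: calH_cup|exact: h1].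
Qed.

End Masks.
End Elements.

(** * Configurations and points *)

Section MasksMeasure.
Context {R : realType} (B : finType).
Local Notation I01 := (@I01 R).
Implicit Types (b : B -> calQ R) (k : option nat) (U : {set {ffun B -> bool}}).

Lemma cell1P b k m x : cell b k [set m]%SET x <-> I01 x /\ mask b k x = m.
Proof. by rewrite /cell /= inE; split=> -[Ix /eqP]. Qed.

Lemma mu_cell b k U : mu (cell b k U) = \sum_(m in U) mu (cell b k [set m]%SET).
Proof.
have {1}-> : U = [set m in enum U]%SET by apply/setP => m; rewrite inE mem_enum.
rewrite -big_enum /=; elim: (enum U) (enum_uniq U) => [_|m s IH /= /andP[ms us]].
  by rewrite big_nil (_ : cell _ _ _ = set0) ?mu0//; apply/seteqP;
    split=> x // [_]; rewrite inE.
rewrite big_cons -IH// -mu_disjU; [|exact: calH_cell|exact: calH_cell|].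
  congr mu; apply/seteqP; split=> x.
    by move=> [Ix]; rewrite !inE => /orP[e|e]; [left|right]; split=> //; rewrite inE.
  by move=> [] [Ix]; rewrite inE => e; split=> //; rewrite !inE e ?orbT.
apply/seteqP; split=> x // -[/cell1P[_ e] [_]].
by rewrite inE e (negbTE ms).
Qed.

Lemma cellC b k U : I01 `\` cell b k U = cell b k (~: U)%SET.
Proof.
apply/seteqP; split=> x.
  by move=> [Ix nU]; split=> //; rewrite inE; apply/negP => xU; apply: nU.
by move=> [Ix]; rewrite inE => /negP nU; split=> // -[].
Qed.

Lemma cellI b k U V : cell b k U `&` cell b k V = cell b k (U :&: V)%SET.
Proof.
apply/seteqP; split=> x; first by move=> [[Ix xU] [_ xV]]; split=> //; rewrite inE xU.
by move=> [Ix]; rewrite inE => /andP[].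
Qed.

Lemma cell_setn b k j : cell b k [set m : {ffun B -> bool} | m j]%SET = setn k (b j).
Proof.
apply/seteqP; split=> x; first by move=> [_]; rewrite inE ffunE => /asboolP.
move=> h; split; first exact: calH_sub (calH_setn _ _) _ h.
by rewrite inE ffunE; apply/asboolP.
Qed.

Definition fresh b k := forall j n, k = Some n -> cls (b j) <> Some n.

(** If no element has class [k], each [setn k (b j)] is empty or all of $[0,1)$, and the number [k]
    leaves no mark. *)
Lemma cell_fresh b k : fresh b k -> cell b k = cell b None.
Proof.
move=> fk; have e j : setn k (b j) = setn None (b j).
  case: (b j) (fk j) => [||n X] //= /(_ n).
  by case: eqP => // <- /(_ erefl).
apply/funext => U; apply/seteqP; split=> x [Ix h]; split=> //; move: h;
  by rewrite (_ : mask b k x = mask b None x)//; apply/ffunP => j; rewrite !ffunE e.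
Qed.

End MasksMeasure.

(** Finite index types make adjoining a variable easy: one of [A], [B], [C] is replaced by its
    [option], with [None] for the new entry. *)
Record config (P R0 Q : Type) (A B C : finType) :=
  Config { cP : A -> P; cQ : B -> Q; cR : C -> R0 }.

Section Configurations.
Context {R : realType}.
Variable S : set (nat -> R).
Hypothesis hS : admissible S.
Local Notation I01 := (@I01 R).
Local Notation config := (config {a : nat -> R | S a} R (calQ R)).

(** * Diagrams and tame predicates *)

Section Diagram.
Variables A B C : finType.
Implicit Types c : config A B C.

(* [None] indexes a class to which none of the elements belongs. *)
Definition clo (b : B -> calQ R) (o : option B) : option nat :=
  if o is Some i then cls (b i) else None.

(** In the last summand an element stands for its class. This keeps the type finite and the facts
    independent of how classes are numbered. *)
Definition fact : finType :=
  (B * B + B + (A * B + A * A) + option B * {ffun B -> bool})%type.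

Definition holds c (f : fact) : Prop :=
  match f with
  | inl (inl (inl (i, j))) => qsim (cQ c i) (cQ c j)
  | inl (inl (inr i)) => cQ c i = QTop R
  | inl (inr (inl (h, j))) => qIn (sval (cP c h)) (cQ c j)
  | inl (inr (inr (h, h'))) => cP c h = cP c h'
  | inr (o, m) => cell (cQ c) (clo (cQ c) o) [set m]%SET !=set0
  end.

Definition diagram c : {ffun fact -> bool} := [ffun f => `[< holds c f >]].

Lemma diagramP c (t : {ffun fact -> bool}) :
  diagram c = t <-> forall f, holds c f <-> t f.
Proof.
split=> [<- f|H]; first by rewrite ffunE; split=> /asboolP.
by apply/ffunP => f; rewrite ffunE; apply/asboolP/idP => /H.
Qed.

Lemma diagram_eqP c c' : diagram c = diagram c' <-> forall f, holds c f <-> holds c' f.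
Proof.
rewrite diagramP; have d f : holds c' f <-> diagram c' f.
  by rewrite ffunE; split=> /asboolP.
by split=> H f; rewrite H d.
Qed.

Definition vol c (o : option B) (m : {ffun B -> bool}) : R :=
  mu (cell (cQ c) (clo (cQ c) o) [set m]%SET).

Definition config_facts : (config A B C -> Prop) -> Prop :=
  fun P => exists f, P = holds^~ f.

Definition config_gens : (config A B C -> R) -> Prop :=
  fun g => (exists k, g = fun c => cR c k) \/
           (exists o m, g = fun c => vol c o m).

Definition tame := semilin config_facts config_gens.
Definition linear_fun := lin config_gens.

Lemma tame_holds f : tame (holds^~ f).
Proof. by apply: semilin_fact; exists f. Qed.

Lemma tame_diagram t : tame (fun c => diagram c = t).
Proof.
apply: (@semilin_ext _ _ _ _ (fun c => forall f, holds c f <-> t f)).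
  by move=> c; rewrite diagramP.
apply: semilin_forallfin => f; case: (t f).
  by apply: (semilin_ext _ (tame_holds f)) => c; split=> [h|[_ h]]; [split|exact: h].
by apply: (semilin_ext _ (semilin_not (tame_holds f))) => c; split=> [h|[h _ /h]];
  [split|].
Qed.

(** There are finitely many diagrams and having a given one is tame, so tameness may be proved with
    the diagram fixed. *)
Lemma tame_fiber (P : config A B C -> Prop) :
  (forall c0, exists2 Q, tame Q & forall c, diagram c = diagram c0 -> P c <-> Q c) ->
  tame P.
Proof.
move=> H; apply: (semilin_fiber (D := diagram)) => [t|t]; first exact: tame_diagram.
have [[c0 <-]|no] := pselect (exists c0, diagram c0 = t); first exact: H.
exists (fun=> False); first exact: semilin_false.
by move=> c e; exfalso; apply: no; exists c.
Qed.

Lemma tame_invariant (P : config A B C -> Prop) :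
  (forall c c', diagram c = diagram c' -> P c -> P c') -> tame P.
Proof.
move=> H; apply: tame_fiber => c0; exists (fun=> P c0); first exact: semilin_cst.
by move=> c e; split; apply: H.
Qed.

Section SameDiagram.
Variables (c c' : config A B C) (e : diagram c = diagram c').

Lemma same_sim i j : qsim (cQ c i) (cQ c j) <-> qsim (cQ c' i) (cQ c' j).
Proof. exact: (iffLR (diagram_eqP c c') e (inl (inl (inl (i, j))))). Qed.

Lemma same_top i : cQ c i = QTop R <-> cQ c' i = QTop R.
Proof. exact: (iffLR (diagram_eqP c c') e (inl (inl (inr i)))). Qed.

Lemma same_In h j : qIn (sval (cP c h)) (cQ c j) <-> qIn (sval (cP c' h)) (cQ c' j).
Proof. exact: (iffLR (diagram_eqP c c') e (inl (inr (inl (h, j))))). Qed.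

Lemma same_eqP h h' : cP c h = cP c h' <-> cP c' h = cP c' h'.
Proof. exact: (iffLR (diagram_eqP c c') e (inl (inr (inr (h, h'))))). Qed.

Lemma same_cell o m : cell (cQ c) (clo (cQ c) o) [set m]%SET !=set0 <->
  cell (cQ c') (clo (cQ c') o) [set m]%SET !=set0.
Proof. exact: (iffLR (diagram_eqP c c') e (inr (o, m))). Qed.

(** A diagram knows classes only up to renumbering; [n] and [n'] correspond as soon as one element
    carries them on the two sides. *)
Lemma same_cls i j n n' : cls (cQ c i) = Some n -> cls (cQ c' i) = Some n' ->
  cls (cQ c j) = Some n <-> cls (cQ c' j) = Some n'.
Proof.
move=> en en'; split=> ej.
  have /same_sim/qsim_cls[p []] : qsim (cQ c i) (cQ c j) by apply/qsim_cls; exists n.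
  by rewrite en' => -[<-].
have /same_sim/qsim_cls[p []] : qsim (cQ c' i) (cQ c' j) by apply/qsim_cls; exists n'.
by rewrite en => -[<-].
Qed.

Lemma same_clsN i : cls (cQ c i) = None <-> cls (cQ c' i) = None.
Proof.
split=> ei.
  case ei' : (cls (cQ c' i)) => [n|//].
  have /same_sim/qsim_cls[p []] : qsim (cQ c' i) (cQ c' i) by apply/qsim_cls; exists n.
  by rewrite ei.
case ei' : (cls (cQ c i)) => [n|//].
have /same_sim/qsim_cls[p []] : qsim (cQ c i) (cQ c i) by apply/qsim_cls; exists n.
by rewrite ei.
Qed.

(** For an element of class [n], membership of the coordinate is a fact about [In]; any other
    element contributes according to whether it is the top. *)
Lemma same_mask h n n' :
  (forall i, cls (cQ c i) = Some n <-> cls (cQ c' i) = Some n') ->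
  mask (cQ c) (Some n) (sval (cP c h) n) = mask (cQ c') (Some n') (sval (cP c' h) n').
Proof.
move=> H; apply/maskP => j; rewrite ffunE.
have Ih : I01 (sval (cP c h) n) by exact: (adm_sub hS (svalP (cP c h))).
have Ih' : I01 (sval (cP c' h) n') by exact: (adm_sub hS (svalP (cP c' h))).
have [ej|nej] := pselect (cls (cQ c j) = Some n).
  rewrite -(qIn_cls _ ej) same_In (qIn_cls _ (iffLR (H j) ej)).
  by split=> /asboolP.
have nej' : cls (cQ c' j) <> Some n' by move/H.
rewrite (setn_other (or_intror nej) Ih) same_top.
rewrite -(setn_other (or_intror nej') Ih').
by split=> /asboolP.
Qed.

End SameDiagram.

End Diagram.
Arguments clo {B} b o.

(** * Extension by a point *)

Section PointExtension.
Variables A B C : finType.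
Implicit Types (c : config A B C) (a : {a : nat -> R | S a}).

Definition extP c a : config (option A) B C :=
  Config (fun h => if h is Some h' then cP c h' else a) (cQ c) (cR c).

(** Injectivity of $(a,n)\mapsto a(n)$. It separates distinct points inside every class. *)
Lemma admissible_eq a a' n : sval a n = sval a' n -> a = a'.
Proof.
case: a a' => [a Sa] [a' Sa'] /= e.
have [] // : (a, n) = (a', n) by apply: (adm_inj hS) => //; rewrite inE.
by move=> ea; subst a'; congr exist; exact: Prop_irrelevance.
Qed.

Lemma extP_diagram c c0 a a0 : diagram c = diagram c0 ->
  (forall h, a = cP c h <-> a0 = cP c0 h) ->
  (forall j, qIn (sval a) (cQ c j) <-> qIn (sval a0) (cQ c0 j)) ->
  diagram (extP c a) = diagram (extP c0 a0).
Proof.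
move=> e Hp Hin; apply/diagram_eqP => -[[[[i j]|i]|[[h j]|[h h']]]|[f m]].
- exact: (same_sim e i j).
- exact: (same_top e i).
- by case: h => [h|] /=; [exact: (same_In e h j)|exact: Hin].
- case: h h' => [h|] [h'|] /=;
    [exact: (same_eqP e h h')|by split=> /esym/Hp|exact: Hp|by split].
- exact: (same_cell e f m).
Qed.

(** The box is a cube, hence meets [S]. Shrinking it in coordinate [0], away from the finitely many
    given points, makes the point found a new one. *)
Lemma point_in_box (u w : nat -> R) (A0 : finType) (f : A0 -> {a : nat -> R | S a}) :
  (forall n, [/\ 0 <= u n, u n < w n & w n <= 1]) ->
  finite_set [set n | ~ (u n = 0 /\ w n = 1)] ->
  exists a : {a : nat -> R | S a},
    (forall h, a <> f h) /\ forall n, u n <= sval a n < w n.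
Proof.
move=> uw fin; have [u0 uw0 w1] := uw 0%N.
have [u' [w' [uu' u'w' w'w avoid]]] :=
  avoid_itv [seq sval (f h) 0%N | h <- enum A0] uw0.
pose U n := if n is 0%N then u' else u n; pose W n := if n is 0%N then w' else w n.
have UW n : [/\ 0 <= U n, U n < W n & W n <= 1].
  by case: n => [|n]; [split; rewrite /U /W; lra|exact: uw].
have [|a [Sa Ca]] := adm_cube hS (C := [set x | forall n, `[U n, W n[%classic (x n)]).
- exists U, W; split => //.
  + by exists U => n /=; rewrite in_itv/= lexx; have [] := UW n.
  + move=> x H n; move: (H n); rewrite I01E /= in_itv/= => /andP[h1 h2].
    by have [] := UW n; lra.
  + apply: (@sub_finite_set _ _ ([set n | ~ (u n = 0 /\ w n = 1)] `|` [set 0%N])).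
      by move=> [|n]; [right|left].
    by rewrite finite_setU; split => //; exact: finite_set1.
exists (exist _ a Sa); split=> [h e|n] /=; last first.
  move: (Ca n); rewrite /= in_itv/=; case: n => [|n]//=; lra.
apply: (avoid (a 0%N)); last by have := Ca 0%N; rewrite /= in_itv.
by apply/mapP; exists h; rewrite ?mem_enum// -e.
Qed.

(** An old point is matched with its counterpart. For a new one, each occupied class confines one
    coordinate to an interval inside the atom corresponding to that of [a0]; finitely many classes
    are occupied, so these conditions define a cube. *)
Lemma extP_homogeneous c c0 a0 : diagram c = diagram c0 ->
  exists a, diagram (extP c a) = diagram (extP c0 a0).
Proof.
move=> e; have [[h0 ->]|new] := pselect (exists h, a0 = cP c0 h).
  exists (cP c h0); apply: extP_diagram => // [h|j]; first exact: (same_eqP e).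
  exact: (same_In e).
have /choice[u_w Huw] : forall n, exists uw : R * R,
    [/\ [/\ 0 <= uw.1, uw.1 < uw.2 & uw.2 <= 1],
        ~ (exists j, cls (cQ c j) = Some n) -> uw.1 = 0 /\ uw.2 = 1 &
        forall x, uw.1 <= x < uw.2 -> forall j, cls (cQ c j) = Some n ->
          setn (Some n) (cQ c j) x <-> qIn (sval a0) (cQ c0 j)].
  move=> n.
  have [[i ei]|no] := pselect (exists j, cls (cQ c j) = Some n); last first.
    exists (0, 1); split => //= x _ j ej; exfalso; apply: no; by exists j.
  case ei0 : (cls (cQ c0 i)) => [n0|]; last by move/(same_clsN e): ei0; rewrite ei.
  (* The atom of [a0] in the class of [i] is nonempty; this is a fact and passes to [c], where the
     atom contains an interval. *)
  pose m := mask (cQ c0) (Some n0) (sval a0 n0).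
  have : cell (cQ c0) (clo (cQ c0) (Some i)) [set m]%SET !=set0.
    exists (sval a0 n0); apply/cell1P; rewrite /= ei0; split=> //.
    exact: (adm_sub hS (svalP a0)).
  move=> /(same_cell e) [x]; rewrite /= ei => /(calH_contains_itv (calH_cell _ _ _)).
  move=> [d [d0 xd sub]].
  have x0 : 0 <= x.
    have /sub/cell1P[+ _] : `[x, x + d[%classic x by rewrite /= in_itv/= lexx; lra.
    by rewrite I01E => /andP[].
  exists (x, x + d); split=> /= [|[]|y xy j ej]; [split; lra|by exists i|].
  have /sub/cell1P[_ /maskP/(_ j) ->] : `[x, x + d[%classic y by rewrite /= in_itv.
  have ej0 := iffLR (same_cls e j ei ei0) ej.
  by rewrite (qIn_cls _ ej0) ffunE; split=> /asboolP.
have [||a [neq Ha]] := @point_in_box (fst \o u_w) (snd \o u_w) A (cP c).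
- by move=> n; have [] := Huw n.
- apply: (@sub_finite_set _ _ [set (odflt 0%N (cls (cQ c j))) | j in [set: B]]).
    move=> n /= h; have [_ H _] := Huw n.
    have [[j ej]|no] := pselect (exists j, cls (cQ c j) = Some n).
      by exists j => //; rewrite ej.
    by exfalso; apply/h/H.
  exact: finite_image.
exists a; apply: extP_diagram => // [h|j].
  by split=> [/neq//|ea0]; exfalso; apply: new; exists h.
case ej : (cls (cQ c j)) => [n|].
  by rewrite (qIn_cls _ ej); have [_ _ H] := Huw n; exact: H (Ha n) j ej.
by rewrite (qIn_triv _ ej) (qIn_triv _ (iffLR (same_clsN e j) ej)); exact: (same_top e).
Qed.

End PointExtension.
End Configurations.

(** * Extension by an element *)

Section ElementExtension.
Context {R : realType}.
Variable S : set (nat -> R).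
Hypothesis hS : admissible S.
Local Notation I01 := (@I01 R).
Local Notation config := (config {a : nat -> R | S a} R (calQ R)).
Variables A B C : finType.
Implicit Types (c : config A B C) (q : calQ R) (m : {ffun B -> bool}).
Implicit Types (oo : option (option B)) (mm : {ffun option B -> bool}).

Definition extb (b : B -> calQ R) q (o : option B) : calQ R :=
  if o is Some j then b j else q.

Definition extQ c q : config A (option B) C := Config (cP c) (extb (cQ c) q) (cR c).

Definition restr mm : {ffun B -> bool} := [ffun j => mm (Some j)].

Definition extm m (e : bool) : {ffun option B -> bool} :=
  [ffun o => if o is Some j then m j else e].

Lemma extmK m e : restr (extm m e) = m.
Proof. by apply/ffunP => j; rewrite !ffunE. Qed.

Lemma cell_extb b q k mm x : cell (extb b q) k [set mm]%SET x <->
  cell b k [set restr mm]%SET x /\ (setn k q x <-> mm None).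
Proof.
rewrite !cell1P; split=> [[Ix /maskP H]|[[Ix /maskP H] h]].
  split; last exact: (H None).
  by split=> //; apply/maskP => j; rewrite ffunE; exact: (H (Some j)).
split=> //; apply/maskP => -[j|]; last exact: h.
by rewrite (H j) ffunE.
Qed.

(** [oo] names the class of the new element, the only class whose atoms [q] can cut; relative to any
    other class [q] is empty or full. *)
Definition linked (b : B -> calQ R) q oo :=
  exists2 n, clo (extb b q) oo = Some n & cls q = Some n.

Lemma linkedP b q oo :
  linked b q oo <-> if oo is Some o then qsim q (extb b q o) else False.
Proof.
case: oo => [p|]; last by split=> // -[].
rewrite qsim_cls; split=> [[n e1 e2]|[n [e1 e2]]]; by exists n.
Qed.

Lemma unlinkedP b q oo : ~ linked b q oo ->
  clo (extb b q) oo = clo b (obind id oo) /\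
  forall x, I01 x -> setn (clo b (obind id oo)) q x <-> q = QTop R.
Proof.
move=> nl; have e : clo (extb b q) oo = clo b (obind id oo).
  case: oo nl => [[i|]|] //= nl; case e : (cls q) => [n|] //.
  by exfalso; apply: nl; exists n.
split=> // x; apply: setn_other; rewrite -e.
case e' : (clo _ oo) => [n|]; [right=> e''|by left].
by apply: nl; exists n.
Qed.

Definition trace b q m : set R := cell b (cls q) [set m]%SET `&` setn (cls q) q.

Definition cotrace b q m : set R := cell b (cls q) [set m]%SET `\` setn (cls q) q.

Lemma cell_linked b q oo mm : linked b q oo ->
  cell (extb b q) (clo (extb b q) oo) [set mm]%SET =
  (if mm None then trace else cotrace) b q (restr mm).
Proof.
move=> [n -> <-]; case e : (mm None); apply/seteqP; split=> x.
- by move=> /cell_extb[h1]; rewrite e => h2; split=> //; apply/h2.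
- by move=> [h1 h2]; apply/cell_extb; rewrite e.
- by move=> /cell_extb[h1]; rewrite e => h2; split=> // /h2.
- by move=> [h1 h2]; apply/cell_extb; rewrite e.
Qed.

Lemma cell_unlinked b q oo mm : ~ linked b q oo ->
  cell (extb b q) (clo (extb b q) oo) [set mm]%SET =
  if `[< q = QTop R >] == mm None then cell b (clo b (obind id oo)) [set restr mm]%SET
  else set0.
Proof.
move=> /unlinkedP[-> H]; apply/seteqP; split=> x.
  move=> /cell_extb[h1]; have [Ix _] := h1; rewrite (H _ Ix) => h2.
  case: eqP => // ne; apply: ne; apply/asboolP/idP => /h2//.
case: eqP => // emm h; apply/cell_extb; rewrite -emm; split=> //.
have [Ix _] := h; rewrite (H _ Ix); by split=> /asboolP.
Qed.

Lemma extQ_diagram c c0 q q0 : diagram c = diagram c0 ->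
  (forall i, qsim q (cQ c i) <-> qsim q0 (cQ c0 i)) -> (qsim q q <-> qsim q0 q0) ->
  (q = QTop R <-> q0 = QTop R) ->
  (forall h, qIn (sval (cP c h)) q <-> qIn (sval (cP c0 h)) q0) ->
  (forall m, trace (cQ c) q m !=set0 <-> trace (cQ c0) q0 m !=set0) ->
  (forall m, cotrace (cQ c) q m !=set0 <-> cotrace (cQ c0) q0 m !=set0) ->
  diagram (extQ c q) = diagram (extQ c0 q0).
Proof.
move=> e Hs Hss Ht Hin Htr Hcotr.
have Hs' i : qsim (cQ c i) q <-> qsim (cQ c0 i) q0.
  have sC (u v : calQ R) : qsim u v <-> qsim v u.
    by rewrite !qsim_cls; split=> -[n []]; exists n.
  by rewrite sC Hs sC.
apply/diagram_eqP => -[[[[i j]|i]|[[h j]|[h h']]]|[ oo mm]].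
- by case: i j => [i|] [j|] /=;
    [exact: (same_sim e i j)|exact: Hs'|exact: Hs|exact: Hss].
- by case: i => [i|] /=; [exact: (same_top e i)|exact: Ht].
- by case: j => [j|] /=; [exact: (same_In e h j)|exact: Hin].
- exact: (same_eqP e h h').
rewrite /=; have Hl : linked (cQ c) q oo <-> linked (cQ c0) q0 oo.
  by rewrite !linkedP; case: oo => [[i|]|] /=; [exact: Hs|exact: Hss|].
have [l|nl] := pselect (linked (cQ c) q oo).
  have l0 := iffLR Hl l; rewrite (cell_linked _ l) (cell_linked _ l0).
  by case: (mm None).
have nl0 : ~ linked (cQ c0) q0 oo by move/Hl.
rewrite (cell_unlinked _ nl) (cell_unlinked _ nl0) (propext Ht).
case: eqP => // _; first exact: (same_cell e (obind id oo) (restr mm)).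
Qed.

(** An old element in the class of the new one, if there is any. It is read off the diagram of the
    extension, hence is fixed together with it. *)
Definition host (t : {ffun fact A (option B) -> bool}) : option B :=
  [pick i | t (inl (inl (inl (None, Some i))))].

(** If no old element shares the class of [q], then that class has the same atoms as the class
    [None]. *)
Lemma cell_host c q :
  cell (cQ c) (cls q) = cell (cQ c) (clo (cQ c) (host (diagram (extQ c q)))).
Proof.
rewrite /host; case: pickP => [i|no] /=.
  by rewrite ffunE => /asboolP/qsim_cls[n [/= -> ->]].
apply: cell_fresh => j n en ej.
have := no j; rewrite ffunE => /asboolP; apply.
by apply/qsim_cls; exists n.
Qed.

Lemma calH_trace b q m : calH (trace b q m).
Proof. by apply: calH_cap; [exact: calH_cell|exact: calH_setn]. Qed.

Lemma calH_cotrace b q m : calH (cotrace b q m).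
Proof. by apply: calH_diff; [exact: calH_cell|exact: calH_setn]. Qed.

Lemma mu_cotrace c q m : mu (cotrace (cQ c) q m) =
  vol c (host (diagram (extQ c q))) m - mu (trace (cQ c) q m).
Proof.
rewrite /vol -cell_host (mu_setID (calH_cell _ (cls q) _) (calH_setn (cls q) q)).
by rewrite /trace /cotrace addrAC subrr add0r.
Qed.

(** Each new volume is an old volume, a trace measure, a difference of two such, or [0], and the
    diagram decides which: the numerical part of the extension is linear in the old one and the
    trace measures. *)
Lemma vol_extQ c q oo mm : vol (extQ c q) oo mm =
  if pselect (linked (cQ c) q oo) then
    if mm None then mu (trace (cQ c) q (restr mm))
    else vol c (host (diagram (extQ c q))) (restr mm) - mu (trace (cQ c) q (restr mm))
  else if `[< q = QTop R >] == mm None then vol c (obind id oo) (restr mm) else 0.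
Proof.
rewrite {1}/vol; case: pselect => [l|nl] /=.
  by rewrite (cell_linked _ l); case: (mm None); rewrite ?mu_cotrace.
by rewrite (cell_unlinked _ nl); case: eqP; rewrite ?mu0.
Qed.

Lemma corresponding_class c c0 n0 : diagram c = diagram c0 ->
  exists n, forall i, cls (cQ c i) = Some n <-> cls (cQ c0 i) = Some n0.
Proof.
move=> e; have [[i ei]|no] := pselect (exists i, cls (cQ c0 i) = Some n0).
  case ei' : (cls (cQ c i)) => [n|]; last by move/(same_clsN e): ei'; rewrite ei.
  by exists n => j; exact: (same_cls e j ei' ei).
(* A number above all those in use is the class of no element. *)
exists (\max_i odflt 0%N (cls (cQ c i))).+1 => i; split=> ei; exfalso.
  have := @leq_bigmax _ (fun i => odflt 0%N (cls (cQ c i))) i.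
  by rewrite ei ltnn.
by apply: no; exists i.
Qed.

Lemma calH_glue b k (X : {ffun B -> bool} -> set R) : (forall m, calH (X m)) ->
  (forall m, X m `<=` cell b k [set m]%SET) ->
  calH [set x | X (mask b k x) x] /\
  forall m, cell b k [set m]%SET `&` [set x | X (mask b k x) x] = X m.
Proof.
move=> hX sX; split; last first.
  move=> m; apply/seteqP; split=> x; first by move=> [/cell1P[_ <-]].
  by move=> Xx; split; [exact: sX|move/sX/cell1P: (Xx) => [_ /= ->]].
rewrite (_ : mkset _ = \big[setU/set0]_(m in [set: {ffun B -> bool}]%SET) X m).
  by elim/big_ind: _ => [|Y Z|m _]; [exact: calH_set0|exact: calH_cup|exact: hX].
rewrite -bigcup_pred; apply/seteqP; split=> x.
  by move=> Xx; exists (mask b k x) => //=; rewrite inE.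
by move=> [m _ Xx] /=; move/sX/cell1P: (Xx) => [_ ->].
Qed.

(** The element is built atom by atom: its trace is empty if [y m = 0], the whole atom if [y m] is
    the volume, and otherwise a part of measure [y m] containing exactly the points whose
    counterparts lie in [q0]. The hypotheses say that the extreme values of [y] occur where the
    trace or the cotrace of [q0] is empty. *)
Lemma extQ_homogeneous c c0 q0 (y : {ffun B -> bool} -> R) :
  diagram c = diagram c0 ->
  (forall m, 0 <= y m <= vol c (host (diagram (extQ c0 q0))) m) ->
  (forall m, 0 < y m <-> trace (cQ c0) q0 m !=set0) ->
  (forall m, y m < vol c (host (diagram (extQ c0 q0))) m <->
             cotrace (cQ c0) q0 m !=set0) ->
  exists q, diagram (extQ c q) = diagram (extQ c0 q0) /\
            forall m, mu (trace (cQ c) q m) = y m.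
Proof.
move=> e ybound ytr ycotr.
have hostE o : host (diagram (extQ c0 q0)) = Some o -> qsim q0 (cQ c0 o).
  by rewrite /host; case: pickP => // i + [<-]; rewrite ffunE => /asboolP.
have hostN : host (diagram (extQ c0 q0)) = None -> forall i, ~ qsim q0 (cQ c0 i).
  by rewrite /host; case: pickP => // no _ i; have := no i; rewrite ffunE => /asboolP.
(* Bottom and top have no host, and their traces are empty or full, which forces [y]. *)
case: q0 => [||n0 X0] in ybound ytr ycotr hostE hostN *.
- have hN : host (diagram (extQ c0 (QBot R))) = None.
    by case h : host => [p|//]; have := hostE _ h.
  exists (QBot R); split; last first.
    move=> m; rewrite /trace setI0 mu0; apply/esym/eqP.
    have /andP[+ _] := ybound m; rewrite le_eqVlt => /orP[/eqP<-//|/ytr[x [_ []]]].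
  apply: extQ_diagram => // m; first by rewrite /trace /= !setI0.
  by rewrite /cotrace /= !setD0; exact: (same_cell e None).
- have hN : host (diagram (extQ c0 (QTop R))) = None.
    by case h : host => [p|//]; have := hostE _ h.
  have tT b m : trace b (QTop R) m = cell b None [set m]%SET.
    by rewrite /trace setIidl//= => x [].
  have cT b m : cotrace b (QTop R) m = set0.
    by apply/seteqP; split=> x //= [[]].
  exists (QTop R); split; last first.
    move=> m; rewrite tT; apply/esym/eqP.
    have /andP[_] := ybound m; rewrite le_eqVlt => /orP[|/ycotr[x]]; last by rewrite cT.
    by rewrite hN.
  apply: extQ_diagram => // m; first by rewrite !tT; exact: (same_cell e None).
  by rewrite !cT.
have [n Hn] := corresponding_class n0 e.
set q0 := QElt n0 X0 in ybound ytr ycotr hostE hostN *.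
have volE m : vol c (host (diagram (extQ c0 q0))) m = mu (cell (cQ c) (Some n) [set
  m]%SET).
  rewrite /vol; congr mu; case h : host => [i|].
    have /qsim_cls[p [[<-] /Hn ei]] := hostE _ h.
    by rewrite /= ei.
  rewrite -(@cell_fresh _ _ _ (Some n))//= => j p [<-] /Hn ej.
  by apply: (hostN h j); apply/qsim_cls; exists n0.
have Hmask h := same_mask hS e h Hn.
pose pt h := sval (cP c h) n; pose pt0 h := sval (cP c0 h) n0.
have I0 h : I01 (pt0 h) by exact: (adm_sub hS (svalP (cP c0 h))).
have I1 h : I01 (pt h) by exact: (adm_sub hS (svalP (cP c h))).
(* The extreme values of [y m] are compatible with the points: a point inside [X0] forces [y m]
   above [0], one outside forces it below the volume. *)
have inX0 h m : mask (cQ c) (Some n) (pt h) = m -> sval X0 (pt0 h) -> 0 < y m.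
  rewrite Hmask => em Xh; apply/ytr; exists (pt0 h); split; last by rewrite setn_cls.
  by apply/cell1P.
have notinX0 h m : mask (cQ c) (Some n) (pt h) = m -> ~ sval X0 (pt0 h) ->
    y m < vol c (host (diagram (extQ c0 q0))) m.
  rewrite Hmask => em Xh; apply/ycotr; exists (pt0 h); split; last by rewrite setn_cls.
  by apply/cell1P.
have /choice[X HX] : forall m, exists X,
    [/\ calH X, X `<=` cell (cQ c) (Some n) [set m]%SET, mu X = y m &
        forall h, mask (cQ c) (Some n) (pt h) = m -> X (pt h) <-> sval X0 (pt0 h)].
  move=> m; have /andP[] := ybound m; rewrite le_eqVlt => /orP[/eqP y0 _|y0].
    exists set0; split; [exact: calH_set0|by []|by rewrite mu0|].
    by move=> h /inX0 H; split=> // /H; rewrite -y0 ltxx.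
  rewrite le_eqVlt => /orP[/eqP yv|yv].
    exists (cell (cQ c) (Some n) [set m]%SET); split;
      [exact: calH_cell|by []|by rewrite yv|].
    move=> h em; split=> [_|_]; last by apply/cell1P.
    by apply: contrapT => /(notinX0 _ _ em); rewrite yv ltxx.
  pose pts (P : A -> Prop) := [seq pt h | h <- enum A &
     `[< P h >] && (mask (cQ c) (Some n) (pt h) == m)].
  have ptsP (P : A -> Prop) x : x \in pts P <->
      exists h, [/\ x = pt h, P h & mask (cQ c) (Some n) (pt h) = m].
    split=> [/mapP[h]|[h [-> Ph em]]].
      by rewrite mem_filter => /andP[/andP[/asboolP Ph /eqP em] _] ->; exists h.
    by apply/mapP; exists h => //; rewrite mem_filter mem_enum em eqxx !andbT;
      apply/asboolP.
  have ycell : 0 < y m < mu (cell (cQ c) (Some n) [set m]%SET) by rewrite y0 -volE.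
  have [||| X [hX sX muX insX outsX]] := calH_split
      (ins := pts (fun h => sval X0 (pt0 h))) (outs := pts (fun h => ~ sval X0 (pt0 h)))
      (calH_cell (cQ c) (Some n) [set m]%SET) ycell.
  - by move=> x /ptsP[h [-> _ em]]; apply/cell1P.
  - by move=> x /ptsP[h [-> _ em]]; apply/cell1P.
  (* Equal coordinates come from equal points, in [c] and hence in [c0]; so no point is both
     required and forbidden. *)
  - move=> x /ptsP[h [-> Xh em]]; apply/negP => /ptsP[h' [eh nXh _]].
    have /(same_eqP e) e0 := admissible_eq hS eh.
    by apply: nXh; rewrite /pt0 -e0.
  exists X; split=> // h em; split=> [Xh|Xh].
    by apply: contrapT => nXh; apply: (outsX (pt h)) => //; apply/ptsP; exists h.
  by apply: insX; apply/ptsP; exists h.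
have [hZ trZ] : calH [set x | X (mask (cQ c) (Some n) x) x] /\
    forall m, cell (cQ c) (Some n) [set m]%SET `&`
      [set x | X (mask (cQ c) (Some n) x) x] = X m.
  by apply: calH_glue => m; have [] := HX m.
set Z := mkset _ in hZ trZ.
have muZ m : mu (cell (cQ c) (Some n) [set m]%SET `&` Z) = y m.
  by rewrite trZ; have [] := HX m.
have trne m : cell (cQ c) (Some n) [set m]%SET `&` Z !=set0 <->
    trace (cQ c0) q0 m !=set0.
  rewrite -ytr -muZ -mu_gt0//; exact: calH_cap (calH_cell _ _ _) hZ.
have cotrne m : cell (cQ c) (Some n) [set m]%SET `\` Z !=set0 <->
    cotrace (cQ c0) q0 m !=set0.
  rewrite -ycotr -mu_gt0; last exact: calH_diff (calH_cell _ _ _) hZ.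
  rewrite volE (mu_setID (calH_cell (cQ c) (Some n) [set m]%SET) hZ) muZ.
  by rewrite ltrDl.
have [hX0 X0n0 X0n1] := svalP X0.
(* [Z] inherits nontriviality from [X0] through the nonempty traces and cotraces. *)
have Zn0 : Z <> set0.
  move=> Z0.
  have [x X0x] : sval X0 !=set0 by apply/set0P/eqP.
  have /trne[z [_]] : trace (cQ c0) q0 (mask (cQ c0) (Some n0) x) !=set0.
    exists x; split; last by rewrite setn_cls.
    by apply/cell1P; split=> //; exact: calH_sub X0x.
  by rewrite Z0.
have Zn1 : Z <> I01.
  move=> Z1; apply: X0n1; apply/seteqP; split=> x; first exact: calH_sub.
  move=> Ix; apply: contrapT => nX0x.
  have /cotrne[z [[Iz _]]] : cotrace (cQ c0) q0 (mask (cQ c0) (Some n0) x) !=set0.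
    exists x; split; last by rewrite setn_cls.
    by apply/cell1P.
  by rewrite Z1.
exists (QElt n (exist _ Z (And3 hZ Zn0 Zn1))).
have eZ : setn (Some n) (QElt n (exist (@calH0 R) Z (And3 hZ Zn0 Zn1))) = Z.
  by rewrite setn_cls.
split; last by move=> m; rewrite /trace eZ.
apply: extQ_diagram => //.
- by move=> i; rewrite !qsim_cls; split=> -[p [[<-] /Hn ei]]; [exists n0|exists n].
- move=> h; rewrite /=; have [_ _ _] := HX (mask (cQ c) (Some n) (pt h)).
  exact.
- by move=> m; rewrite /trace eZ.
- by move=> m; rewrite /cotrace eZ.
Qed.

End ElementExtension.

(** * Projections *)

Section Elimination.
Context {R : realType}.
Variable S : set (nat -> R).
Hypothesis hS : admissible S.
Local Notation config := (config {a : nat -> R | S a} R (calQ R)).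
Variables A B C : finType.
Implicit Types (c : config A B C).

(** A new point leaves the numerical part unchanged. With the diagram [t] of the extension fixed,
    [P] becomes a condition on [c], and by homogeneity the diagram of [c] decides whether [t] is
    realised. *)
Lemma tame_exP (P : config (option A) B C -> Prop) : tame P ->
  tame (fun c => exists a, P (extP c a)).
Proof.
move=> lP; apply: (@semilin_ext _ _ _ _
    (fun c => exists t, exists a, diagram (extP c a) = t /\ P (extP c a))).
  move=> c; split=> [[t [a [_ Pa]]]|[a Pa]]; first by exists a.
  by exists (diagram (extP c a)), a.
apply: semilin_exfin => t.
have [||Q lQ e] := semilin_pullback (F := @config_facts _ S A B C)
    (G := @config_gens _ S A B C)
    (r := fun c (c' : config (option A) B C) =>
      exists a, c' = extP c a /\ diagram c' = t) _ _ lP.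
- move=> _ [f ->]; exists (fun=> t f : Prop); first exact: semilin_cst.
  by move=> c c' [a [_ /diagramP/(_ f)]].
- move=> _ [[k ->]|[w [m ->]]].
    exists (fun c => cR c k); first by apply: lin_gen; left; exists k.
    by move=> c c' [a [-> _]].
  exists (fun c => vol c w m); first by apply: lin_gen; right; exists w, m.
  by move=> c c' [a [-> _]].
apply: (@semilin_ext _ _ _ _ (fun c => (exists a, diagram (extP c a) = t) /\ Q c)).
  move=> c; split=> [[[a ea] /(e c (extP c a)) Pa]|[a [ea Pa]]].
    by exists a; split=> //; apply: Pa; exists a.
  by split; [exists a|apply/(e c (extP c a)) => //; exists a].
apply: semilin_and lQ; apply: tame_invariant => c c' ecc' [a0 ea0].
by have [a ea] := extP_homogeneous hS a0 (esym ecc'); exists a; rewrite ea.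
Qed.

Definition extR c (r : R) : config A B (option C) :=
  Config (cP c) (cQ c) (fun k => if k is Some k' then cR c k' else r).

Lemma tame_exR (P : config A B (option C) -> Prop) : tame P ->
  tame (fun c => exists r, P (extR c r)).
Proof.
apply: semilin_exR => [_ [f ->]|_ [[k ->]|[w [m ->]]]].
- by exists (fun c => holds c f) => //; exact: tame_holds.
- case: k => [k|].
    exists 0, (fun c => cR c k); split; first by apply: lin_gen; left; exists k.
    by move=> c r; rewrite rmorph0 mul0r addr0.
  exists 1, (fun=> 0); split; first exact: lin0.
  by move=> c r; rewrite rmorph1 mul1r add0r.
- exists 0, (fun c => vol c w m); split; first by apply: lin_gen; right; exists w, m.
  by move=> c r; rewrite rmorph0 mul0r addr0.
Qed.

Local Notation J := {ffun B -> bool}.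
Local Notation diag := {ffun fact A (option B) -> bool}.

Definition sim_new (t : diag) (oo : option (option B)) : bool :=
  if oo is Some i then t (inl (inl (inl (None, i)))) else false.

(** [Some None] names the class of the new element within the extension; the bit [e] tells the trace
    from the cotrace. *)
Definition trace_new (t : diag) m (e : bool) : bool := t (inr (Some None, extm m e)).

(** The linear constraints that [t] puts on trace measures. By homogeneity they suffice, provided
    [t] is realised over some configuration with the diagram of [c]. *)
Definition measures_compatible (t : diag) c (y : J -> R) : Prop :=
  forall m, [/\ 0 <= y m, y m <= vol c (host t) m,
                0 < y m <-> trace_new t m true &
                y m < vol c (host t) m <-> trace_new t m false].

Lemma sim_newP c q oo : sim_new (diagram (extQ c q)) oo <-> linked (cQ c) q oo.
Proof.
by rewrite linkedP; case: oo => [i|//]; rewrite /sim_new ffunE; split=> /asboolP.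
Qed.

Lemma trace_newP c q m : trace_new (diagram (extQ c q)) m true <-> trace (cQ c) q m
  !=set0.
Proof.
rewrite /trace_new ffunE; split=> [/asboolP[x /cell_extb]|[x [h1 h2]]].
  by rewrite extmK ffunE => -[h1 h2]; exists x; split=> //; apply/h2.
by apply/asboolP; exists x; apply/cell_extb; rewrite extmK ffunE.
Qed.

Lemma cotrace_newP c q m :
  trace_new (diagram (extQ c q)) m false <-> cotrace (cQ c) q m !=set0.
Proof.
rewrite /trace_new ffunE; split=> [/asboolP[x /cell_extb]|[x [h1 h2]]].
  by rewrite extmK ffunE => -[h1 h2]; exists x; split=> // /h2.
by apply/asboolP; exists x; apply/cell_extb; rewrite extmK ffunE.
Qed.

Lemma trace_measures_compatible c q :
  measures_compatible (diagram (extQ c q)) c (fun m => mu (trace (cQ c) q m)).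
Proof.
move=> m; have := mu_cotrace c q m; have := mu_ge0 (cotrace (cQ c) q m) => h0 h1.
split; first exact: mu_ge0.
- lra.
- by rewrite trace_newP mu_gt0//; exact: calH_trace.
- rewrite cotrace_newP -mu_gt0; last exact: calH_cotrace.
  by rewrite h1 subr_gt0.
Qed.

(** With the diagram [t] of the extension fixed, the quantifier over [q] splits into realisability
    of [t] and a quantifier over the vector [y] of trace measures, in which [P] has become
    semilinear. *)
Lemma tame_exQ (P : config A (option B) C -> Prop) : tame P ->
  tame (fun c => exists q, P (extQ c q)).
Proof.
move=> lP; apply: (@semilin_ext _ _ _ _
    (fun c => exists t, exists q, diagram (extQ c q) = t /\ P (extQ c q))).
  move=> c; split=> [[t [q [_ Pq]]]|[q Pq]]; first by exists q.
  by exists (diagram (extQ c q)), q.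
apply: semilin_exfin => t.
pose F := fst_facts (R := R) (@config_facts _ S A B C) (J := J).
pose G := vec_gens (@config_gens _ S A B C) (enum J).
have lvol w m : lin G (fun z => vol z.1 w m).
  by apply: lin_gen; left; exists (fun c => vol c w m) => //; right; exists w, m.
have ly m : lin G (fun z => z.2 m).
  by apply: lin_gen; right; exists m => //; rewrite mem_enum.
have [||Q lQ e] := semilin_pullback (F := F) (G := G)
    (r := fun z (c' : config A (option B) C) =>
      exists q, [/\ c' = extQ z.1 q, diagram c' = t &
       forall m, mu (trace (cQ z.1) q m) = z.2 m]) _ _ lP.
- move=> _ [f ->]; exists (fun=> t f : Prop); first exact: semilin_cst.
  by move=> c c' [q [_ /diagramP/(_ f)]].
- move=> _ [[k ->]|[ oo [mm ->]]].
    exists (fun z => cR z.1 k); last by move=> c c' [q [-> _ _]].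
    by apply: lin_gen; left; exists (fun c => cR c k) => //; left; exists k.
  exists (fun z => if sim_new t oo then
      if mm None then z.2 (restr mm)
      else vol z.1 (host t) (restr mm) - z.2 (restr mm)
    else if t (inl (inl (inr None))) == mm None
    then vol z.1 (obind id oo) (restr mm) else 0).
    case: (sim_new _ _); first by case: (mm None) => //; exact: lin_sub.
    by case: eqP => _ //; exact: lin0.
  move=> [c y] _ [q [-> <- /= ey]];
    rewrite vol_extQ ey /= (ffunE _ (inl (inl (inr None)))) /=.
  case: pselect => [/sim_newP ->//|nl].
  rewrite (_ : sim_new _ _ = false)//.
  by apply/negP => /sim_newP.
have lcompat : semilin F G (fun z => measures_compatible t z.1 z.2).
  apply: semilin_forallfin => m.
  apply: (@semilin_ext _ _ _ _ (fun z : config A B C * (J -> R) =>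
     (0 <= z.2 m /\ z.2 m <= vol z.1 (host t) m) /\
     (if trace_new t m true then 0 < z.2 m else z.2 m <= 0) /\
     (if trace_new t m false then z.2 m < vol z.1 (host t) m
      else vol z.1 (host t) m <= z.2 m))).
    move=> z; split=> [[[h1 h2] [h3 h4]]|[h1 h2 h3 h4]].
      split=> //; [case: (trace_new t m true) h3|case: (trace_new t m false) h4] => h.
      - by rewrite h.
      - by split=> //; rewrite ltNge h.
      - by rewrite h.
      - by split=> //; rewrite ltNge h.
    split=> //; split.
      case: (trace_new t m true) h3 => h; first exact/h.
      by rewrite leNgt; apply/negP => /h.
    case: (trace_new t m false) h4 => h; first exact/h.
    by rewrite leNgt; apply/negP => /h.
  apply: semilin_and; first by apply: semilin_and; apply: semilin_le => //; exact: lin0.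
  apply: semilin_and.
    by case: (trace_new t m true); [apply: semilin_lt|apply: semilin_le] => //;
      exact: lin0.
  by case: (trace_new t m false); [apply: semilin_lt|apply: semilin_le].
(* Realisability is asked over some configuration with the same diagram, which makes it invariant by
   its very form. *)
have lE : tame (fun c => exists c0, diagram c0 = diagram c /\
    exists q0, diagram (extQ c0 q0) = t).
  by apply: tame_invariant => c1 c2 <-.
apply: (@semilin_ext _ _ _ _ (fun c => (exists c0, diagram c0 = diagram c /\
    exists q0, diagram (extQ c0 q0) = t) /\
    exists y, measures_compatible t c y /\ Q (c, y))).
  move=> c; split.
    move=> [[c0 [ec0 [q0 et]]] [y [ycomp Qy]]].
    have [|||q [eq ey]] := extQ_homogeneous (y := y) hS (esym ec0) (q0 := q0).
    - by move=> m; rewrite et; have [-> ->] := ycomp m.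
    - by move=> m; have [_ _ -> _] := ycomp m; rewrite -et trace_newP.
    - by move=> m; rewrite et; have [_ _ _ ->] := ycomp m; rewrite -et cotrace_newP.
    exists q; rewrite eq; split=> //.
    by apply/(e (c, y)) => //; exists q; rewrite eq.
  move=> [q [et Pq]]; split; first by exists c; split=> //; exists q.
  exists (fun m => mu (trace (cQ c) q m)); split.
    by rewrite -et; exact: trace_measures_compatible.
  by apply/(e _ (extQ c q)) => //; exists q.
apply: semilin_and lE _.
exact: (semilin_exRn (semilin_and lcompat lQ)).
Qed.

End Elimination.

(** * Normal forms of terms *)

Section NormalForms.
Context {R : realType}.
Variable S : set (nat -> R).
Hypothesis hS : admissible S.
Local Notation I01 := (@I01 R).
Local Notation config := (config {a : nat -> R | S a} R (calQ R)).
Variables A B C : finType.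
Implicit Types (c : config A B C) (u : option B) (U : {set {ffun B -> bool}}).

(** A union of atoms in the class named by [u]. The code [(u, U)] makes sense in every
    configuration, so that elements can be compared across configurations with the same diagram. *)
Definition elt c u U : calQ R :=
  qmk (clo (cQ c) u) (cell (cQ c) (clo (cQ c) u) U).

Lemma cell_set0 (b : B -> calQ R) k : cell b k finset.set0 = set0.
Proof. by apply/seteqP; split=> x // [_]; rewrite inE. Qed.

Lemma cell_setT (b : B -> calQ R) k : cell b k [set: {ffun B -> bool}]%SET = I01.
Proof. by apply/seteqP; split=> x [] // Ix; split=> //; rewrite inE. Qed.

(** Only nonempty atoms count, and the diagram lists them. *)
Lemma cell_eqP (b : B -> calQ R) k U V : cell b k U = cell b k V <->
  forall m, cell b k [set m]%SET !=set0 -> (m \in U) = (m \in V).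
Proof.
split=> [e m [x /cell1P[Ix em]]|H].
  have : cell b k U x <-> cell b k V x by rewrite e.
  by rewrite /cell /= em => -[h1 h2]; apply/idP/idP => h;
    [have [] := h1 (conj Ix h)|have [] := h2 (conj Ix h)].
apply/seteqP; split=> x [Ix h]; split=> //.
  by rewrite -H//; exists x; apply/cell1P.
by rewrite H//; exists x; apply/cell1P.
Qed.

Lemma same_cell_eq c c' u U V : diagram c = diagram c' ->
  cell (cQ c) (clo (cQ c) u) U = cell (cQ c) (clo (cQ c) u) V ->
  cell (cQ c') (clo (cQ c') u) U = cell (cQ c') (clo (cQ c') u) V.
Proof. by move=> e /cell_eqP H; apply/cell_eqP => m /(same_cell e)/H. Qed.

(** No element belongs to the class [None], so all points of $[0,1)$ have the same mask. *)
Lemma cell_None (b : B -> calQ R) U : cell b None U = set0 \/ cell b None U = I01.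
Proof.
have e x : I01 x -> mask b None x = [ffun j => `[< b j = QTop R >]].
  move=> Ix; apply/maskP => j; rewrite ffunE (setn_other (or_introl erefl) Ix).
  by split=> /asboolP.
have [h|h] := boolP ([ffun j => `[< b j = QTop R >]] \in U); [right|left].
  by apply/seteqP; split=> x [] // Ix; split=> //; rewrite e.
by apply/seteqP; split=> x // [Ix]; rewrite e// (negbTE h).
Qed.

Lemma eltP c u U :
  [\/ elt c u U = QBot R /\ cell (cQ c) (clo (cQ c) u) U = set0,
      elt c u U = QTop R /\ cell (cQ c) (clo (cQ c) u) U = I01 |
      exists i n X, [/\ u = Some i, cls (cQ c i) = Some n, elt c u U = QElt n X,
                        sval X = cell (cQ c) (Some n) U & sval X <> set0 /\ sval X
                          <> I01]].
Proof.
rewrite /elt; set X := cell _ _ _.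
have [X0|X0] := pselect (X = set0); first by apply: Or31; rewrite X0 qmk_set0.
have [X1|X1] := pselect (X = I01); first by apply: Or32; rewrite X1 qmk_I01.
apply: Or33; have hX : calH X by exact: calH_cell.
case eu : (clo (cQ c) u) => [n|]; last first.
  by move: X0 X1; rewrite /X eu => h0 h1; case: (cell_None (cQ c) U).
have [X' eX' ->] := qmk_eltP n hX X0 X1.
case: u => [i|//] in X eu hX X0 X1 eX' *.
by exists i, n, X'; split=> //; rewrite eX' // /X eu.
Qed.

Lemma elt_botP c u U : elt c u U = QBot R <-> cell (cQ c) (clo (cQ c) u) U = set0.
Proof.
split=> [|e]; last by rewrite /elt e qmk_set0.
by case: (eltP c u U) => [[]//|[->]//|[i [n [X [_ _ ->]]]]].
Qed.

Lemma elt_topP c u U : elt c u U = QTop R <-> cell (cQ c) (clo (cQ c) u) U = I01.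
Proof.
split=> [|e]; last by rewrite /elt e qmk_I01.
by case: (eltP c u U) => [[->]//|[]//|[i [n [X [_ _ ->]]]]].
Qed.

Lemma elt_Elt c u U n X : elt c u U = QElt n X ->
  clo (cQ c) u = Some n /\ sval X = cell (cQ c) (Some n) U.
Proof.
case: (eltP c u U) => [[->]//|[->]//|[i [n' [X' [-> ei -> eX' _]]]]] [<- <-].
by rewrite /= ei.
Qed.

Lemma qell_elt c u U : qell (elt c u U) = \sum_(m in U) vol c u m.
Proof.
rewrite /vol -mu_cell; case: (eltP c u U) => [[-> ->]|[-> ->]|].
- by rewrite mu0.
- by rewrite mu_I01.
- by move=> [i [n [X [-> ei -> eX _]]]]; rewrite /= ei -eX.
Qed.

Lemma elt_compl c u U : qcompl (elt c u U) = elt c u (~: U)%SET.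
Proof.
case: (eltP c u U) => [[-> e]|[-> e]|[i [n [X [-> ei e eX _]]]]].
- by apply/esym/elt_topP; rewrite -cellC e setD0.
- by apply/esym/elt_botP; rewrite -cellC e setDv.
- rewrite /elt /= ei qcompl_qmk ?cellC//; exact: calH_cell.
Qed.

Lemma elt_set0 c u : elt c u finset.set0 = QBot R.
Proof. by apply/elt_botP; exact: cell_set0. Qed.

Lemma elt_setT c u : elt c u [set: {ffun B -> bool}]%SET = QTop R.
Proof. by apply/elt_topP; exact: cell_setT. Qed.

Lemma elt_var c j : cQ c j = elt c (Some j) [set m : {ffun B -> bool} | m j]%SET.
Proof. by rewrite /elt cell_setn /= qmk_cls. Qed.

Section SameElements.
Variables (c c' : config A B C) (e : diagram c = diagram c').

Lemma same_elt_bot u U : elt c u U = QBot R -> elt c' u U = QBot R.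
Proof.
move=> /elt_botP h; apply/elt_botP.
by rewrite -(cell_set0 (cQ c') (clo (cQ c') u)); apply: (same_cell_eq e);
  rewrite cell_set0.
Qed.

Lemma same_elt_top u U : elt c u U = QTop R -> elt c' u U = QTop R.
Proof.
move=> /elt_topP h; apply/elt_topP.
by rewrite -(cell_setT (cQ c') (clo (cQ c') u)); apply: (same_cell_eq e);
  rewrite cell_setT.
Qed.

End SameElements.

Lemma same_elt_class c c' u u' U U' n n' X X' : diagram c = diagram c' ->
  elt c u U = QElt n X -> elt c' u U = QElt n' X' ->
  (exists Y, elt c u' U' = QElt n Y) -> exists Y, elt c' u' U' = QElt n' Y.
Proof.
move=> e h h' [Y hY]; have [eu _] := elt_Elt h; have [eu' _] := elt_Elt h'.
case: (eltP c' u' U') => [[/(same_elt_bot (esym e))]|[/(same_elt_top (esym e))]|].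
- by rewrite hY.
- by rewrite hY.
move=> [i [m [Z [eu2 ei hZ _ _]]]]; exists Z; rewrite hZ; congr QElt.
have [] := elt_Elt hY; rewrite eu2 /= => ei' _.
case: u eu eu' {h h'} => [j|//] /= ej ej'.
by have /iffLR/(_ ei') := same_cls e i ej ej'; rewrite ei => -[].
Qed.

(** Equal nontrivial elements share a class, even if [u] and [u'] name it differently; atoms are
    compared after moving both sides to the class of [u]. *)
Lemma same_elt_eq c c' u u' U U' : diagram c = diagram c' ->
  elt c u U = elt c u' U' -> elt c' u U = elt c' u' U'.
Proof.
move=> e; case h : (elt c u U) => [||n X] /esym h1.
- by rewrite (same_elt_bot e h) (same_elt_bot e h1).
- by rewrite (same_elt_top e h) (same_elt_top e h1).
have [eu eX] := elt_Elt h; have [eu1 eX1] := elt_Elt h1.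
case h' : (elt c' u U) => [||n' X'].
- by move: (same_elt_bot (esym e) h'); rewrite h.
- by move: (same_elt_top (esym e) h'); rewrite h.
have [Y hY] := same_elt_class e h h' (ex_intro _ X h1).
have [eu' eX'] := elt_Elt h'; have [eu1' eY] := elt_Elt hY.
rewrite hY -!qmk_Elt eX' eY -eu'; congr qmk.
by apply: (same_cell_eq e); rewrite eu -eX -eX1.
Qed.

Lemma same_elt_sim c c' u u' U U' : diagram c = diagram c' ->
  qsim (elt c u U) (elt c u' U') -> qsim (elt c' u U) (elt c' u' U').
Proof.
move=> e; case h : (elt c u U) => [||n X] //; case h1 : (elt c u' U') => [||m Y] //= nm.
subst m; case h' : (elt c' u U) => [||n' X'].
- by move: (same_elt_bot (esym e) h'); rewrite h.
- by move: (same_elt_top (esym e) h'); rewrite h.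
by have [Z ->] := same_elt_class e h h' (ex_intro _ Y h1).
Qed.

Lemma same_elt_In c c' h u U : diagram c = diagram c' ->
  qIn (sval (cP c h)) (elt c u U) -> qIn (sval (cP c' h)) (elt c' u U).
Proof.
move=> e; case h1 : (elt c u U) => [||n X] //; first by rewrite (same_elt_top e h1).
move=> /= hX; case h1' : (elt c' u U) => [||n' X'] //=.
  by move: (same_elt_bot (esym e) h1'); rewrite h1.
have [eu eX] := elt_Elt h1; have [eu' eX'] := elt_Elt h1'.
rewrite eX'; split; first exact: (adm_sub hS (svalP (cP c' h))).
case: u eu eu' {h1 h1'} => [i|//] /= ei ei'.
rewrite -(same_mask hS e h (fun j => same_cls e j ei ei')).
by move: hX; rewrite eX => -[].
Qed.

(** A code of a meet, found in one configuration by [elt_cap_ex], is thereby valid in all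
    configurations with the same diagram. *)
Lemma same_elt_cap c c' u u' U U' w W : diagram c = diagram c' ->
  qcap (elt c u U) (elt c u' U') = elt c w W ->
  qcap (elt c' u U) (elt c' u' U') = elt c' w W.
Proof.
move=> e; case h : (elt c u U) => [||n X].
- rewrite qcap_bot => /esym/(same_elt_bot e) ->.
  by rewrite (same_elt_bot e h) qcap_bot.
- by rewrite qcap_top (same_elt_top e h) qcap_top; exact: same_elt_eq.
case h1 : (elt c u' U') => [||m Y].
- rewrite qcap_bot => /esym/(same_elt_bot e) ->.
  by rewrite (same_elt_bot e h1) qcap_bot.
- by rewrite qcap_top (same_elt_top e h1) qcap_top -h; exact: same_elt_eq.
case h' : (elt c' u U) => [||n' X'].
- by move: (same_elt_bot (esym e) h'); rewrite h.
- by move: (same_elt_top (esym e) h'); rewrite h.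
have [nm|nm] := eqVneq n m; last first.
  rewrite /= (negbTE nm) => /esym/(same_elt_bot e) ->.
  case h1' : (elt c' u' U') => [||m' Y'] //=.
    by move: (same_elt_top (esym e) h1'); rewrite h1.
  case: eqP => // nm'; subst m'.
  have [Z] := same_elt_class (esym e) h' h (ex_intro _ Y' h1').
  by rewrite h1 => -[mn]; rewrite mn eqxx in nm.
subst m; have [Z h1'] := same_elt_class e h h' (ex_intro _ Y h1).
have [eu eX] := elt_Elt h; have [_ eY] := elt_Elt h1.
have [eu' eX'] := elt_Elt h'; have [_ eZ] := elt_Elt h1'.
have key (c1 : config A B C) n1 X1 Y1 : clo (cQ c1) u = Some n1 ->
    sval X1 = cell (cQ c1) (Some n1) U -> sval Y1 = cell (cQ c1) (Some n1) U' ->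
    qcap (QElt n1 X1) (QElt n1 Y1) = elt c1 u (U :&: U')%SET.
  move=> e1 e2 e3; rewrite -!qmk_Elt e2 e3 qcap_qmk; [|exact: calH_cell|exact: calH_cell].
  by rewrite cellI /elt e1.
rewrite h1' (key _ _ _ _ eu eX eY) (key _ _ _ _ eu' eX' eZ).
exact: same_elt_eq.
Qed.

Lemma elt_cap_ex c u u' U U' :
  exists w W, qcap (elt c u U) (elt c u' U') = elt c w W.
Proof.
case h : (elt c u U) => [||n X].
- by exists None, finset.set0; rewrite qcap_bot elt_set0.
- by exists u', U'; rewrite qcap_top.
case h1 : (elt c u' U') => [||m Y].
- by exists None, finset.set0; rewrite qcap_bot elt_set0.
- by exists u, U; rewrite qcap_top h.
have [nm|nm] := eqVneq n m; last first.
  by exists None, finset.set0; rewrite /= (negbTE nm) elt_set0.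
subst m; have [eu eX] := elt_Elt h; have [_ eY] := elt_Elt h1.
exists u, (U :&: U')%SET; rewrite -!qmk_Elt eX eY qcap_qmk;
  [|exact: calH_cell|exact: calH_cell].
by rewrite cellI /elt eu.
Qed.

End NormalForms.

(** * Formulas and tame predicates *)

Section Valuations.
Context {R : realType}.
Variable S : set (nat -> R).
Hypothesis hS : admissible S.
Local Notation I01 := (@I01 R).
Local Notation config := (config {a : nat -> R | S a} R (calQ R)).
Local Notation M := (Mhalf hS).
Variables A B C : finType.
Variables (gP : A -> nat) (gQ : B -> nat) (gR : C -> nat).
Implicit Types (v : assignment M) (c : config A B C).

Definition cfg v : config A B C :=
  Config (fun h => v (SP, gP h)) (fun j => v (SQ, gQ j)) (fun k => v (SR, gR k)).

Definition named (x : var) : Prop :=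
  match x with
  | (SP, n) => exists h, gP h = n
  | (SQ, n) => exists j, gQ j = n
  | (SR, n) => exists k, gR k = n
  end.

(** The code depends on the diagram but not on the valuation. One code cannot serve all diagrams,
    since a meet depends on whether the classes agree. *)
Definition elt_rep (f : assignment M -> calQ R) : Prop :=
  forall c0, exists u U, forall v, diagram (cfg v) = diagram c0 -> f v = elt (cfg v) u U.

Definition lin_rep (f : assignment M -> R) : Prop :=
  forall c0, exists2 l, @linear_fun _ S A B C l &
    forall v, diagram (cfg v) = diagram c0 -> f v = l (cfg v).

Definition rep (s : sort) : (assignment M -> car M s) -> Prop :=
  match s with
  | SP => fun f => exists h, forall v, f v = cP (cfg v) h
  | SQ => fun f => elt_rep f
  | SR => fun f => lin_rep f
  end.

Lemma elt_rep_compl f : elt_rep f -> elt_rep (fun v => qcompl (f v)).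
Proof.
move=> hf c0; have [u [U H]] := hf c0; exists u, (~: U)%SET => v /H ->.
exact: elt_compl.
Qed.

Lemma elt_rep_cap f g : elt_rep f -> elt_rep g -> elt_rep (fun v => qcap (f v) (g v)).
Proof.
move=> hf hg c0; have [u [U H]] := hf c0; have [u' [U' H']] := hg c0.
have [w [W e]] := elt_cap_ex c0 u u' U U'; exists w, W => v ev.
by rewrite H// H'//; apply: (same_elt_cap (esym ev)).
Qed.

Lemma rep_eval s (t : term s) : (forall x, x \in tvars t -> named x) ->
  rep (fun v => eval v t).
Proof.
elim: t => /= {s} [x|t1 IH1 t2 IH2|t1 IH1 t2 IH2|t IH|||t IH|t1 IH1 t2 IH2||].
- move=> /(_ x (mem_head _ _)); case: x => -[] n [h <-] /=.
  + by exists h.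
  + by move=> c0; exists (Some h), [set m : {ffun B -> bool} | m h]%SET => v _;
      exact: (elt_var (cfg v) h).
  + by move=> c0; exists (fun c => cR c h) => //; apply: lin_gen; left; exists h.
- move=> H; apply: elt_rep_cap; [apply: IH1|apply: IH2] => x xt;
    by apply: H; rewrite mem_cat xt ?orbT.
- move=> H c0; have [||u [U H']] := elt_rep_compl (elt_rep_cap
    (elt_rep_compl (IH1 _)) (elt_rep_compl (IH2 _))) c0.
  + by move=> x xt; apply: H; rewrite mem_cat xt.
  + by move=> x xt; apply: H; rewrite mem_cat xt orbT.
  by exists u, U => v ev; rewrite qcup_qcompl H'.
- by move=> H; apply: elt_rep_compl; exact: IH.
- by move=> _ c0; exists None, finset.set0 => v _; rewrite elt_set0.
- by move=> _ c0; exists None, [set: {ffun B -> bool}]%SET => v _; rewrite elt_setT.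
- move=> H c0; have [u [U H']] := IH H c0.
  exists (fun c => \sum_(m in U) vol c u m); last by move=> v ev; rewrite H'// qell_elt.
  by apply: lin_sum => m; apply: lin_gen; right; exists u, m.
- move=> H c0; have [|l1 ll1 e1] := IH1 _ c0; first by move=> x xt; apply: H;
    rewrite mem_cat xt.
  have [|l2 ll2 e2] := IH2 _ c0; first by move=> x xt; apply: H; rewrite mem_cat xt orbT.
  by exists (fun c => l1 c + l2 c); [exact: lin_add|move=> v ev; rewrite e1// e2].
- by move=> _ c0; exists (fun=> 0) => //; exact: lin0.
- by move=> _ c0; exists (fun=> 1) => //; exact: lin_one.
Qed.

Definition tame_on (P : assignment M -> Prop) : Prop :=
  exists2 Q : config A B C -> Prop, tame Q & forall v, P v <-> Q (cfg v).

Lemma tame_on_fiber P :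
  (forall c0 : config A B C, exists2 Q : config A B C -> Prop, tame Q &
     forall v, diagram (cfg v) = diagram c0 -> P v <-> Q (cfg v)) ->
  tame_on P.
Proof.
move=> H; have /choice[Q HQ] : forall t, exists Q : config A B C -> Prop, tame Q /\
    forall v, diagram (cfg v) = t -> P v <-> Q (cfg v).
  move=> t; have [[c0 <-]|no] := pselect (exists c0 : config A B C, diagram c0 = t).
    by have [Q] := H c0; exists Q.
  exists (fun=> False); split; first exact: semilin_false.
  by move=> v e; exfalso; apply: no; exists (cfg v).
exists (fun c => exists t, diagram c = t /\ Q t c).
  apply: semilin_exfin => t; apply: semilin_and; first exact: tame_diagram.
  by have [] := HQ t.
move=> v; split=> [Pv|[t [e Qv]]].
  by exists (diagram (cfg v)); split=> //; have [_ <-] := HQ (diagram (cfg v)).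
by have [_ /(_ v e) ->] := HQ t.
Qed.

Lemma tame_on_invariant P :
  (forall c0 : config A B C, exists p : Prop,
     forall v, diagram (cfg v) = diagram c0 -> P v <-> p) -> tame_on P.
Proof.
move=> H; apply: tame_on_fiber => c0; have [p Hp] := H c0.
by exists (fun=> p) => //; exact: semilin_cst.
Qed.

Lemma tame_on_sat (phi : formula) : quantifier_free phi ->
  (forall x, x \in fv phi -> named x) -> tame_on (fun v => sat v phi).
Proof.
elim: phi => [s t1 t2|t1 t2|t1 t2|t1 t2|p IH|p IHp q IHq|p IHp q IHq|//|//] qf H.
- have r1 : rep (fun v => eval v t1) by apply: rep_eval => x xt; apply: H;
    rewrite mem_cat xt.
  have r2 : rep (fun v => eval v t2) by apply: rep_eval => x xt; apply: H;
    rewrite mem_cat xt orbT.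
  case: s t1 t2 r1 r2 {H qf} => t1 t2 /=.
  + move=> [h eh] [h' eh']; exists (fun c => cP c h = cP c h'); last by move=> v;
      rewrite eh eh'.
    exact: (tame_holds S C (inl (inr (inr (h, h'))))).
  + move=> r1 r2; apply: tame_on_invariant => c0.
    have [u [U e]] := r1 c0; have [u' [U' e']] := r2 c0.
    exists (elt c0 u U = elt c0 u' U') => v ev; rewrite e// e'//.
    by split; apply: same_elt_eq.
  + move=> r1 r2; apply: tame_on_fiber => c0.
    have [l1 ll1 e1] := r1 c0; have [l2 ll2 e2] := r2 c0.
    exists (fun c => l1 c = l2 c); first exact: semilin_eq.
    by move=> v ev; rewrite e1// e2.
- have [|h eh] := @rep_eval _ t1; first by move=> x xt; apply: H; rewrite /= mem_cat xt.
  have r2 : elt_rep (fun v => eval v t2).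
    by apply: (@rep_eval _ t2) => x xt; apply: H; rewrite /= mem_cat xt orbT.
  apply: tame_on_invariant => c0; have [u [U e]] := r2 c0.
  exists (qIn (sval (cP c0 h)) (elt c0 u U)) => v ev; rewrite /= eh e//.
  by split; apply: (same_elt_In hS).
- have r1 : elt_rep (fun v => eval v t1).
    by apply: (@rep_eval _ t1) => x xt; apply: H; rewrite /= mem_cat xt.
  have r2 : elt_rep (fun v => eval v t2).
    by apply: (@rep_eval _ t2) => x xt; apply: H; rewrite /= mem_cat xt orbT.
  apply: tame_on_invariant => c0.
  have [u [U e]] := r1 c0; have [u' [U' e']] := r2 c0.
  exists (qsim (elt c0 u U) (elt c0 u' U')) => v ev; rewrite /= e// e'//.
  by split; apply: same_elt_sim.
- have r1 : lin_rep (fun v => eval v t1).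
    by apply: (@rep_eval _ t1) => x xt; apply: H; rewrite /= mem_cat xt.
  have r2 : lin_rep (fun v => eval v t2).
    by apply: (@rep_eval _ t2) => x xt; apply: H; rewrite /= mem_cat xt orbT.
  apply: tame_on_fiber => c0.
  have [l1 ll1 e1] := r1 c0; have [l2 ll2 e2] := r2 c0.
  exists (fun c => l1 c < l2 c); first exact: semilin_lt.
  by move=> v ev; rewrite /= e1// e2.
- have [Q lQ e] := IH qf H; exists (fun c => ~ Q c); first exact: semilin_not.
  by move=> v /=; rewrite e.
- have /andP[qp qq] := qf.
  have [|Q1 l1 e1] := IHp qp; first by move=> x xp; apply: H; rewrite /= mem_cat xp.
  have [|Q2 l2 e2] := IHq qq; first by move=> x xp; apply: H; rewrite /= mem_cat xp orbT.
  by exists (fun c => Q1 c /\ Q2 c); [exact: semilin_and|move=> v /=; rewrite e1 e2].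
- have /andP[qp qq] := qf.
  have [|Q1 l1 e1] := IHp qp; first by move=> x xp; apply: H; rewrite /= mem_cat xp.
  have [|Q2 l2 e2] := IHq qq; first by move=> x xp; apply: H; rewrite /= mem_cat xp orbT.
  by exists (fun c => Q1 c \/ Q2 c); [exact: semilin_or|move=> v /=; rewrite e1 e2].
Qed.

(** * From tame predicates to quantifier-free formulas *)

Definition definable (P : assignment M -> Prop) : Prop :=
  exists psi : formula, [/\ quantifier_free psi, forall x, x \in fv psi -> named x &
    forall v, P v <-> sat v psi].

(* Definability is closed under Boolean operations, hence is itself an instance
   of [semilin], whose closure lemmas then apply to it. *)
Definition no_gens : (assignment M -> R) -> Prop := fun=> False.

Lemma lin_no_gens l : lin no_gens l -> exists q : rat, l = fun=> ratr q.
Proof.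
elim=> {l} [//||f g _ [p ->] _ [q ->]|q f _ [p ->]].
- by exists 1; rewrite rmorph1.
- by exists (p + q); apply/funext => v; rewrite rmorphD.
- by exists (q * p); apply/funext => v; rewrite rmorphM.
Qed.

Lemma definable_semilin P : semilin definable no_gens P -> definable P.
Proof.
elim=> {P} [//|l /lin_no_gens[q ->]|P _ [p [qp fp ep]]|P Q _ [p [qp fp ep]] _ [q
  [qq fq eq]]].
(* Without generators a linear function is constant. [0 < 1] and [0 < 0] stand for truth and
   falsity. *)
- have [q0|q0] := boolP (ratr q < 0 :> R).
    exists (FLt TZero TOne); split=> // v; split=> //= _; exact: ltr01.
  exists (FLt TZero TZero); split=> // v; split=> //=.
  by rewrite ltxx.
- by exists (FNot p); split=> // v /=; rewrite ep.
- exists (FAnd p q); split=> /=; first by rewrite qp.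
    by move=> x; rewrite mem_cat => /orP[/fp|/fq].
  by move=> v; rewrite ep eq.
Qed.

(** A coarse part of the diagram, expressible by atomic formulas in the variables. It suffices to
    write a term for each atom, and the facts about atoms are then expressed by these terms. *)
Definition sim_type : finType := (option B * B + B)%type.

Definition sim_holds v (i : sim_type) : Prop :=
  match i with
  | inl (Some i, j) => qsim (cQ (cfg v) i) (cQ (cfg v) j)
  | inl (None, j) => False
  | inr j => cQ (cfg v) j = QTop R
  end.

Definition sim_pattern v : {ffun sim_type -> bool} := [ffun i => `[< sim_holds v i >]].

Lemma named_Q j : named (SQ, gQ j).
Proof. by exists j. Qed.

Lemma definable_sim_pattern t : semilin definable no_gens (fun v => sim_pattern v = t).
Proof.
apply: (@semilin_ext _ _ _ _ (fun v =>
  forall i, if t i then sim_holds v i else ~ sim_holds v i)).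
  move=> v; split=> [H|<- i]; last by rewrite ffunE; case: asboolP.
  apply/ffunP => i; rewrite ffunE; have := H i.
  by case: (t i) => h; apply/asboolP.
apply: semilin_forallfin => i.
have d : definable (fun v => sim_holds v i).
  case: i => [[[i|] j]|j].
  - exists (FSim (Var (SQ, gQ i)) (Var (SQ, gQ j))); split=> // x.
    by rewrite !inE => /orP[]/eqP->; exact: named_Q.
  - by exists (FLt TZero TZero); split=> // v /=; rewrite ltxx.
  - exists (FEq (Var (SQ, gQ j)) TTop); split=> // x.
    by rewrite !inE => /eqP->; exact: named_Q.
by case: (t i); [|apply: semilin_not]; exact: semilin_fact.
Qed.

Section CellTerm.
Variables (t : {ffun sim_type -> bool}) (u : option B) (m : {ffun B -> bool}).

(** A nontrivial element of another class would collapse the meet, so it is replaced by the constant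
    that it amounts to in the class of [u]. *)
Definition literal j : term SQ :=
  if t (inl (u, j)) then Var (SQ, gQ j) else if t (inr j) then TTop else TBot.

Definition cell_term (s : seq B) : term SQ :=
  foldr (fun j T => TCap (if m j then literal j else TCompl (literal j)) T) TTop s.

Lemma cell_term_named s x : x \in tvars (cell_term s) -> named x.
Proof.
elim: s => //= j s IH; rewrite mem_cat => /orP[|//].
have nl : x \in tvars (literal j) -> named x.
  rewrite /literal; case: (t _); last by case: (t _).
  by rewrite inE => /eqP->; exact: named_Q.
by case: (m j).
Qed.

(** The sets on which [qmk k] respects the operations: without a class, only trivial sets are
    represented. *)
Definition well_classed (k : option nat) (X : set R) :=
  calH X /\ (k = None -> X = set0 \/ X = I01).

Lemma qcap_well_classed k X Y : well_classed k X -> well_classed k Y ->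
  qcap (qmk k X) (qmk k Y) = qmk k (X `&` Y) /\ well_classed k (X `&` Y).
Proof.
move=> [hX nX] [hY nY]; split; last first.
  split; first exact: calH_cap.
  move=> kN; have [->|->] := nX kN; first by left; rewrite set0I.
  by have [->|->] := nY kN; [left; rewrite setI0|right; rewrite setIid].
case: k nX nY => [n _ _|nX nY]; first exact: qcap_qmk.
have [->|->] := nX erefl; first by rewrite set0I qmk_set0.
by rewrite qmk_I01 qcap_top setIidr//; exact: calH_sub.
Qed.

Lemma qcompl_well_classed k X : well_classed k X ->
  qcompl (qmk k X) = qmk k (I01 `\` X) /\ well_classed k (I01 `\` X).
Proof.
move=> [hX nX]; split; last first.
  split; first exact: calH_compl.
  by move=> kN; have [->|->] := nX kN; [right; rewrite setD0|left; rewrite setDv].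
case: k nX => [n _|nX]; first exact: qcompl_qmk.
have [->|->] := nX erefl; first by rewrite setD0 qmk_set0 qmk_I01.
by rewrite setDv qmk_set0 qmk_I01.
Qed.

Lemma literalP v j : sim_pattern v = t ->
  let k := clo (cQ (cfg v)) u in
  eval v (literal j) = qmk k (setn k (cQ (cfg v) j)) /\
  well_classed k (setn k (cQ (cfg v) j)).
Proof.
move=> et k; split; last first.
  split=> [|kN]; first exact: calH_setn.
  by rewrite kN; case: (cQ _ _) => [||n X] /=; [left|right|left].
have linkE : t (inl (u, j)) <-> exists2 n, k = Some n & cls (cQ (cfg v) j) = Some n.
  rewrite -et ffunE /k; split=> [/asboolP|[n en ej]].
    by case: u => [i|//] /= /qsim_cls[n [-> ej]]; exists n.
  by apply/asboolP; case: u en => [i|//] /= en; apply/qsim_cls; exists n.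
have topE : t (inr j) <-> cQ (cfg v) j = QTop R.
  by rewrite -et ffunE; split=> /asboolP.
rewrite /literal; case: ifPn => [/linkE[n -> ej]|/negP nl] /=.
  by rewrite -ej qmk_cls.
case: ifPn => [/topE /= ->|/negP nt]; first by rewrite qmk_I01.
rewrite (_ : setn _ _ = set0) ?qmk_set0//; apply/seteqP; split=> x // h.
have Ix := calH_sub (calH_setn _ _) h; apply: nt; apply/topE.
have other : k = None \/ cls (cQ (cfg v) j) <> k.
  case ek : k => [n|]; [right=> ej|by left].
  by apply: nl; apply/linkE; exists n.
exact/(setn_other other Ix).
Qed.

Lemma eval_cell_term v : sim_pattern v = t -> eval v (cell_term (enum B)) = elt
  (cfg v) u [set m]%SET.
Proof.
move=> et; set k := clo (cQ (cfg v)) u.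
have H s : eval v (cell_term s) = qmk k [set x | I01 x /\ forall j,
  j \in s -> setn k (cQ (cfg v) j) x <-> m j]
   /\ well_classed k [set x | I01 x /\ forall j,
     j \in s -> setn k (cQ (cfg v) j) x <-> m j].
  elim: s => [|j s [IH wIH]] /=.
    rewrite (_ : mkset _ = I01); last by apply/seteqP; split=> x; [case|].
    by rewrite qmk_I01; split=> //; split; [exact: calH_I01|right].
  have [e w] := literalP j et.
  have {e w}[e w] : eval v (if m j then literal j else TCompl (literal j)) =
      qmk k [set x | I01 x /\ (setn k (cQ (cfg v) j) x <-> m j)] /\
      well_classed k [set x | I01 x /\ (setn k (cQ (cfg v) j) x <-> m j)].
    case: (m j).
      rewrite (_ : mkset _ = setn k (cQ (cfg v) j))//; apply/seteqP; split=> x.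
        by move=> [_ ->].
      by move=> h; split=> //; exact: calH_sub (calH_setn _ _) _ h.
    rewrite (_ : mkset _ = I01 `\` setn k (cQ (cfg v) j)).
      by rewrite /= e; exact: qcompl_well_classed.
    by apply/seteqP; split=> x [Ix h]; split=> // /h.
  rewrite e IH; have [-> w'] := qcap_well_classed w wIH.
  suff eZ : [set x | I01 x /\ forall i, i \in j :: s -> setn k (cQ (cfg v) i) x <-> m i] =
      [set x | I01 x /\ (setn k (cQ (cfg v) j) x <-> m j)] `&`
      [set x | I01 x /\ forall j, j \in s -> setn k (cQ (cfg v) j) x <-> m j].
    by rewrite eZ.
  apply/seteqP; split=> x.
    move=> [Ix h]; split; split=> //; first by apply: h; rewrite mem_head.
    by move=> i si; apply: h; rewrite inE si orbT.
  by move=> [[Ix h] [_ h']]; split=> // i; rewrite inE => /orP[/eqP->|/h'].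
have [-> _] := H (enum B); congr qmk; apply/seteqP; split=> x.
  by move=> [Ix h]; apply/cell1P; split=> //; apply/maskP => j; apply: h;
    rewrite mem_enum.
by move=> /cell1P[Ix /maskP h]; split=> // j _; exact: h.
Qed.

End CellTerm.

Fixpoint tmuln (n : nat) (T : term SR) : term SR :=
  if n is n'.+1 then TAdd T (tmuln n' T) else TZero.

Lemma eval_tmuln n T v : eval v (tmuln n T) = n%:R * (eval v T : R).
Proof.
elim: n => [|n IH] /=; first by rewrite mul0r.
by rewrite IH -natr1 addrC mulrDl mul1r.
Qed.

Lemma tvars_tmuln n T x : x \in tvars (tmuln n T) -> x \in tvars T.
Proof. by elim: n => //= n IH; rewrite mem_cat => /orP[|/IH]. Qed.

(** A positive integer factor clears the denominators, and negative contributions go to a second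
    term; the sign of [l] then becomes a comparison of two terms. *)
Lemma linear_fun_terms t l : @linear_fun _ S A B C l ->
  exists (n : nat) (T1 T2 : term SR), [/\ (0 < n)%N,
    forall x, x \in tvars T1 -> named x, forall x, x \in tvars T2 -> named x &
    forall v, sim_pattern v = t -> n%:R * l (cfg v) = eval v T1 - eval v T2].
Proof.
elim=> {l} [_ [[k ->]|[w [m ->]]]||f g _ [n [T1 [T2 [n0 n1 n2 e]]]] _ [n' [T1' [T2'
  [n0' n1' n2' e']]]]|].
- exists 1%N, (Var (SR, gR k)), TZero; split=> // x.
    by rewrite inE => /eqP->; exists k.
  by rewrite mul1r /= subr0.
- exists 1%N, (TEll (cell_term t w m (enum B))), TZero; split=> // [x|v et].
    exact: cell_term_named.
  by rewrite mul1r /= subr0 (eval_cell_term _ _ et) qell_elt big_set1.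
- exists 1%N, TOne, TZero; split=> // v _.
  by rewrite /= subr0 mul1r.
- exists (n * n')%N, (TAdd (tmuln n' T1) (tmuln n T1')),
    (TAdd (tmuln n' T2) (tmuln n T2')).
  split=> [||| v et]; first by rewrite muln_gt0 n0.
  + by move=> x; rewrite mem_cat => /orP[/tvars_tmuln/n1|/tvars_tmuln/n1'].
  + by move=> x; rewrite mem_cat => /orP[/tvars_tmuln/n2|/tvars_tmuln/n2'].
  rewrite [eval v (TAdd _ _)]/= [X in _ - X]/= !eval_tmuln natrM.
  have := e _ et; have := e' _ et.
  move: (eval v T1 : R) (eval v T2 : R) (eval v T1' : R) (eval v T2' : R) =>
    a b a' b' h1 h2.
  rewrite mulrDr {1}(mulrC n%:R) -!mulrA h1 h2 !mulrBr /=; lra.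
- move=> q f _ [n [T1 [T2 [n0 n1 n2 e]]]].
  have dq : (0 < `|denq q|)%N by rewrite absz_gt0 denq_neq0.
  have eq v : sim_pattern v = t ->
      (n * `|denq q|)%N%:R * (ratr q * f (cfg v)) = (numq q)%:~R * (eval v T1 -
        eval v T2) :> R.
    move=> et; rewrite -(e _ et) natrM /ratr.
    have -> : `|denq q|%N%:R = (denq q)%:~R :> R.
      by rewrite -[in RHS](gez0_abs (ltW (denq_gt0 q))).
    have : (denq q)%:~R != 0 :> R by rewrite intr_eq0 denq_neq0.
    move: (denq q)%:~R (numq q)%:~R n%:R (f _) => d a k y d0.
    by field.
  (* A negative numerator exchanges the two terms. *)
  case: (intP (numq q)) eq => [|k|k] eq.
  + exists (n * `|denq q|)%N, TZero, TZero; split=> // [|v et];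
      first by rewrite muln_gt0 n0.
    by rewrite eq// mul0r /= subr0.
  + exists (n * `|denq q|)%N, (tmuln k.+1 T1), (tmuln k.+1 T2); split=> [|x|x|v et].
    * by rewrite muln_gt0 n0.
    * by move=> /tvars_tmuln/n1.
    * by move=> /tvars_tmuln/n2.
    * by rewrite eq// !eval_tmuln mulrBr.
  + exists (n * `|denq q|)%N, (tmuln k.+1 T2), (tmuln k.+1 T1); split=> [|x|x|v et].
    * by rewrite muln_gt0 n0.
    * by move=> /tvars_tmuln/n2.
    * by move=> /tvars_tmuln/n1.
    * by rewrite eq// !eval_tmuln -mulrBr rmorphN mulNr -mulrN opprB.
Qed.

Lemma definable_tame (P : config A B C -> Prop) : tame P ->
  definable (fun v => P (cfg v)).
Proof.
move=> lP; apply: definable_semilin; elim: lP => {P} [_ [f ->]|l ll|P _|P Q _ IHP _].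
- case: f => [[[[i j]|j]|[[h j]|[h h']]]|[w m]] /=.
  + apply: semilin_fact; exists (FSim (Var (SQ, gQ i)) (Var (SQ, gQ j))); split=> // x.
    by rewrite !inE => /orP[]/eqP->; exact: named_Q.
  + apply: semilin_fact; exists (FEq (Var (SQ, gQ j)) TTop); split=> // x.
    by rewrite !inE => /eqP->; exact: named_Q.
  + apply: semilin_fact; exists (FIn (Var (SP, gP h)) (Var (SQ, gQ j))); split=> // x.
    by rewrite !inE => /orP[]/eqP->; [exists h|exact: named_Q].
  + apply: semilin_fact; exists (FEq (Var (SP, gP h)) (Var (SP, gP h'))); split=> // x.
    by rewrite !inE => /orP[]/eqP->; [exists h|exists h'].
  apply: (semilin_fiber (D := sim_pattern)) => t; first exact: definable_sim_pattern.
  exists (fun v => ~ (eval v (cell_term t w m (enum B)) = QBot R)).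
    apply: semilin_not; apply: semilin_fact.
    exists (FEq (cell_term t w m (enum B)) TBot); split=> // x.
    by rewrite /= cats0; exact: cell_term_named.
  move=> v et; rewrite (eval_cell_term _ _ et) elt_botP.
  by split=> [/set0P/eqP|/eqP/set0P].
- apply: (semilin_fiber (D := sim_pattern)) => t; first exact: definable_sim_pattern.
  have [n [T1 [T2 [n0 n1 n2 e]]]] := linear_fun_terms t ll.
  exists (fun v => (eval v T1 : R) < eval v T2).
    apply: semilin_fact; exists (FLt T1 T2); split=> // x.
    by rewrite mem_cat => /orP[/n1|/n2].
  move=> v et; have n0' : 0 < n%:R :> R by rewrite ltr0n.
  by rewrite -(pmulr_rlt0 (l (cfg v)) n0') (e _ et) subr_lt0.
- exact: semilin_not.
- exact: semilin_and.
Qed.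

End Valuations.

(** * Quantifier elimination *)

Section Transfer.
Implicit Types (M : structure) (phi psi : formula).

Lemma dfwith_same M (v : assignment M) x : eqtype.dfwith v (v x) = v.
Proof.
apply: functional_extensionality_dep => y.
by case: (eqtype.dfwithP v (v x)).
Qed.

Definition closure phi (s : seq var) : formula := foldr FAll phi s.

Lemma fv_closure phi s : fv (closure phi s) = [seq y <- fv phi | y \notin s].
Proof.
elim: s => [|x s IH] /=; first by rewrite filter_predT.
by rewrite IH -filter_predI; apply: eq_filter => y; rewrite !inE negb_or.
Qed.

Lemma closure_sentence phi : sentence (closure phi (fv phi)).
Proof.
rewrite /sentence fv_closure; apply/eqP; rewrite -(negbK (_ == _)) -has_filter.
by apply/hasPn => y; rewrite negbK.
Qed.

Lemma valid_closure M phi s : valid_in M (closure phi s) <-> valid_in M phi.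
Proof.
split=> [H v|H]; last by elim: s => [//|x s IH] v /= a; exact: IH.
move: (H v) => {H}; elim: s => [//|x s IH] /= /(_ (v x)).
by rewrite dfwith_same; exact: IH.
Qed.

Definition fiff phi psi := FAnd (FOr (FNot phi) psi) (FOr (FNot psi) phi).

Lemma sat_fiff M (v : assignment M) phi psi :
  sat v (fiff phi psi) <-> (sat v phi <-> sat v psi).
Proof.
rewrite /=; split=> [[h1 h2]|H]; first by split=> h; [case: h1|case: h2].
by rewrite !H; have [h|h] := pselect (sat v psi); split; auto.
Qed.

(** The universal closure of the equivalence is a sentence true in [M], hence belongs to [Th M]. *)
Lemma transfer_equivalence M N phi psi : model (Th M) N ->
  (forall v : assignment M, sat v phi <-> sat v psi) ->
  forall v : assignment N, sat v phi <-> sat v psi.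
Proof.
move=> HN HM v; apply/sat_fiff.
have /HN/valid_closure/(_ v) // : Th M (closure (fiff phi psi) (fv (fiff phi psi))).
split; first exact: closure_sentence.
by apply/valid_closure => w; apply/sat_fiff.
Qed.

End Transfer.

Section QuantifierElimination.
Context {R : realType}.
Variable S : set (nat -> R).
Hypothesis hS : admissible S.
Local Notation M := (Mhalf hS).

Definition qf_on (V : seq var) (P : assignment M -> Prop) : Prop :=
  exists psi, [/\ quantifier_free psi, {subset fv psi <= V} & forall v,
    P v <-> sat v psi].

Definition other_vars (phi : formula) (x : var) : seq var := [seq y <- fv phi | y != x].

(** The [seq_sub] of this list serves as a finite index type for configurations. *)
Definition names phi x (s : sort) : seq nat :=
  [seq y.2 | y <- other_vars phi x & y.1 == s].

Definition name phi x s (i : seq_sub (names phi x s)) : nat := ssval i.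
Arguments name : clear implicits.

Definition with_name (I : Type) (f : I -> nat) (n : nat) (i : option I) : nat :=
  if i is Some i then f i else n.

Section Step.
Variables (phi : formula) (x : var).
Implicit Types v : assignment M.

Lemma namesP s n : (n \in names phi x s) = ((s, n) \in other_vars phi x).
Proof.
apply/mapP/idP => [[[s' n'] + /= ->]|h].
  by rewrite mem_filter => /andP[/eqP/= ->].
by exists (s, n) => //; rewrite mem_filter eqxx.
Qed.

Lemma name_other s i : (s, name phi x s i) \in other_vars phi x.
Proof. by rewrite -namesP; exact: valP i. Qed.

Lemma dfwith_name s i v a :
  (eqtype.dfwith v (i := x) a : assignment M) (s, name phi x s i) = v (s, name phi x s i).
Proof.
have := name_other i; rewrite mem_filter => /andP[ix _].
by rewrite eqtype.dfwith_out// eq_sym.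
Qed.

Lemma name_ex s n : (s, n) \in fv phi -> (s, n) <> x -> exists i, name phi x s i = n.
Proof.
move=> h /eqP nx; have h' : n \in names phi x s by rewrite namesP mem_filter nx.
by exists (SeqSub h').
Qed.

Lemma with_name_ex s n : (s, n) \in fv phi -> x.1 = s ->
  exists i, with_name (name phi x s) x.2 i = n.
Proof.
move=> h xs; have [e|/eqP nx] := eqVneq (s, n) x; first by exists None; rewrite -e.
by have [i <-] := name_ex h nx; exists (Some i).
Qed.

Lemma definable_qf_on (P : assignment M -> Prop) :
  definable (hS := hS) (name phi x SP) (name phi x SQ) (name phi x SR) P ->
  qf_on (other_vars phi x) P.
Proof.
move=> [psi [qf_psi nm e]]; exists psi; split=> // y /nm.
by case: y => -[] n [i <-]; exact: name_other.
Qed.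

End Step.

(** The variable [x] gets the index [None] in its sort, so that changing its value extends the
    configuration of the other variables by one entry; each sort then has its own projection
    result. *)
Lemma qf_on_ex phi x : quantifier_free phi ->
  qf_on (other_vars phi x) (fun v => exists a, sat (eqtype.dfwith v (i := x) a) phi).
Proof.
move=> qf_phi; apply: definable_qf_on.
case: x => -[] n.
- pose x : var := (SP, n).
  have [|Q lQ e] := tame_on_sat hS (gP := with_name (name phi x SP) n)
      (gQ := name phi x SQ) (gR := name phi x SR) qf_phi.
    by move=> -[[] k] h; [exact: with_name_ex|exact: name_ex|exact: name_ex].
  have := definable_tame hS (name phi x SP) (name phi x SQ) (name phi x SR)
    (tame_exP hS lQ).
  congr definable; apply/funext => v; apply/propext.
  suff H a : cfg (hS := hS) (with_name (name phi x SP) n) (name phi x SQ) (name phi x SR)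
      (eqtype.dfwith v (i := x) a) =
      extP (cfg (hS := hS) (name phi x SP) (name phi x SQ) (name phi x SR) v) a.
    by split=> -[a h]; exists a; [apply/e; rewrite H|rewrite -H; apply/e].
  congr Config; apply/funext; [case=> [i|]|move=> i|move=> i];
    rewrite /= ?dfwith_name//; exact: eqtype.dfwith_in.
- pose x : var := (SQ, n).
  have [|Q lQ e] := tame_on_sat hS (gP := name phi x SP)
      (gQ := with_name (name phi x SQ) n) (gR := name phi x SR) qf_phi.
    by move=> -[[] k] h; [exact: name_ex|exact: with_name_ex|exact: name_ex].
  have := definable_tame hS (name phi x SP) (name phi x SQ) (name phi x SR)
    (tame_exQ hS lQ).
  congr definable; apply/funext => v; apply/propext.
  suff H a : cfg (hS := hS) (name phi x SP) (with_name (name phi x SQ) n) (name phi x SR)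
      (eqtype.dfwith v (i := x) a) =
      extQ (cfg (hS := hS) (name phi x SP) (name phi x SQ) (name phi x SR) v) a.
    by split=> -[a h]; exists a; [apply/e; rewrite H|rewrite -H; apply/e].
  congr Config; apply/funext; [move=> i|case=> [i|]|move=> i];
    rewrite /= ?dfwith_name//; exact: eqtype.dfwith_in.
- pose x : var := (SR, n).
  have [|Q lQ e] := tame_on_sat hS (gP := name phi x SP)
      (gQ := name phi x SQ) (gR := with_name (name phi x SR) n) qf_phi.
    by move=> -[[] k] h; [exact: name_ex|exact: name_ex|exact: with_name_ex].
  have := definable_tame hS (name phi x SP) (name phi x SQ) (name phi x SR)
    (tame_exR lQ).
  congr definable; apply/funext => v; apply/propext.
  suff H a : cfg (hS := hS) (name phi x SP) (name phi x SQ) (with_name (name phi x SR) n)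
      (eqtype.dfwith v (i := x) a) =
      extR (cfg (hS := hS) (name phi x SP) (name phi x SQ) (name phi x SR) v) a.
    by split=> -[a h]; exists a; [apply/e; rewrite H|rewrite -H; apply/e].
  congr Config; apply/funext; [move=> i|move=> i|case=> [i|]];
    rewrite /= ?dfwith_name//; exact: eqtype.dfwith_in.
Qed.

Lemma qf_on_sat phi : qf_on (fv phi) (fun v => sat v phi).
Proof.
elim: phi => [s t1 t2|t1 t2|t1 t2|t1 t2|p [p' [qp sp ep]]|p [p' [qp sp ep]] q [q'
  [qq sq eq]]|p [p' [qp sp ep]] q [q' [qq sq eq]]|x p [p' [qp sp ep]]|x p [p' [qp
    sp ep]]].
- by exists (FEq t1 t2); split.
- by exists (FIn t1 t2); split.
- by exists (FSim t1 t2); split.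
- by exists (FLt t1 t2); split.
- by exists (FNot p'); split=> // v /=; rewrite ep.
- exists (FAnd p' q'); split=> [|y|v] /=; [by rewrite qp| |by rewrite ep eq].
  by rewrite !mem_cat => /orP[/sp->//|/sq->]; rewrite orbT.
- exists (FOr p' q'); split=> [|y|v] /=; [by rewrite qp| |by rewrite ep eq].
  by rewrite !mem_cat => /orP[/sp->//|/sq->]; rewrite orbT.
- have [psi [qpsi spsi epsi]] := qf_on_ex x qp.
  exists psi; split=> // [y /spsi|v].
    by rewrite !mem_filter => /andP[-> /sp].
  by rewrite -epsi /=; split=> -[a /ep]; exists a.
- have [psi [qpsi spsi epsi]] := qf_on_ex (phi := FNot p') x qp.
  exists (FNot psi); split=> // [y /spsi|v].
    by rewrite !mem_filter => /andP[-> /sp].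
  rewrite /= -epsi /=; split=> [h [a]|h a]; first by apply; apply/ep.
  by apply: contrapT => na; apply: h; exists a => /ep.
Qed.

End QuantifierElimination.

Theorem theorem7p10 (R : realType) (S : set (nat -> R)) (hS : admissible S) :
  has_quantifier_elimination (Th (Mhalf hS)).
Proof.
move=> phi; have [psi [qf_psi sub e]] := qf_on_sat hS phi.
by exists psi; split=> // N /transfer_equivalence H; exact: H.
Qed.
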